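(* Let $n\ge 2$, let $G_n=(V_n,E_n)$ be any connected graph with $n$ vertices and maximum degree $\Delta_n$, and let $t>0$. Let $f_n(\eta_0,\omega)$ be the consensus opinion of the discrete-time voter model on $G_n$ with initial configuration $\eta_0$ and edge-selection sequence $\omega$, and let $\omega_t$ be the sequence obtained from $\omega$ by running the interchange process up to time $t$. Then $$\mathbb{P}\Big(f_n(\eta_0,\omega)\neq f_n(\eta_0,\omega_t)\Big)\le 3t\cdot\frac{n\Delta_n}{|E_n|}.$$
   Context: Graphs are finite, simple and undirected. $\vec E_n$ denotes the set of directed edges: each $\{x,y\}\in E_n$ gives two directed edges $(x,y)$ and $(y,x)$. Voter model. Fix $p\in(0,1)$. The initial configuration $\eta_0\in\{0,1\}^{V_n}$ has i.i.d. Bernoulli($p$) entries. The sequence $\omega=(\omega(k))_{k\ge1}$ consists of i.i.d. uniform elements of $\vec E_n$ and is independent of $\eta_0$. If $\omega(k+1)=(x,y)$, then $\eta_{k+1}(y)=\eta_k(x)$ and $\eta_{k+1}(z)=\eta_k(z)$ for $z\ne y$. Almost surely $\eta_k$ is eventually constant equal to the all-0 or the all-1 configuration; $f_n(\eta_0,\omega)\in\{0,1\}$ denotes this final common opinion. Interchange noise. The interchange process $(\zeta_t)_{t\ge0}$ on $\mathbb{N}=\{1,2,\dots\}$ is started from $\zeta_0(k)=k$, and for every $k\ge1$ the values at the neighbouring positions $k$ and $k+1$ are swapped at rate one, independently for different $k$. It is independent of $(\eta_0,\omega)$. For each $t$, $\zeta_t$ is a permutation of $\mathbb{N}$, and $\omega_t(k):=\omega(\zeta_t(k))$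 for $k\ge1$. *)

(* Defs.v *)
From HB Require Import structures.
From mathcomp Require Import all_boot all_order all_algebra.
From mathcomp Require Import all_classical all_reals all_analysis.
Set Implicit Arguments.
Unset Strict Implicit.
Unset Printing Implicit Defensive.
Import Order.TTheory GRing.Theory Num.Theory.
Import numFieldNormedType.Exports.

(* Finite simple graphs, as irreflexive symmetric relations on a finType. *)

Definition simple_graph (V : finType) (e : rel V) : Prop :=
  symmetric e /\ irreflexive e.

Definition connected_graph (V : finType) (e : rel V) : Prop :=
  forall x y : V, connect e x y.

Definition edges (V : finType) (e : rel V) : {set {set V}} :=
  [set A : {set V} | [exists x, exists y, e x y && (A == [set x; y]%SET)]]%SET.

Definition max_degree (V : finType) (e : rel V) : nat :=
  \max_(v : V) #|[set w | e v w]%SET|.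

(* For symmetric e, each {x, y} in edges e gives the two elements (x, y) and
   (y, x) of this type. *)
Definition directed_edge (V : finType) (e : rel V) : finType :=
  {xy : V * V | e xy.1 xy.2}.

Local Open Scope classical_set_scope.
Local Open Scope ring_scope.

(* The sequences of edges and the positions of the interchange process are
   indexed from 0: the index k : nat stands for the (k+1)-st element of
   {1, 2, ...}.  In particular w k is the edge used at the (k+1)-st step. *)

Fixpoint voter (V : finType) (e : rel V) (eta0 : V -> bool)
    (w : nat -> directed_edge e) (k : nat) : V -> bool :=
  if k is k'.+1 then
    fun z => if z == (val (w k')).2 then voter eta0 w k' (val (w k')).1
             else voter eta0 w k' z
  else eta0.

(* The final common opinion; the value is false (by convention) when
   consensus is never reached. *)
Definition consensus (V : finType) (e : rel V) (eta0 : V -> bool)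
    (w : nat -> directed_edge e) : bool :=
  `[< exists K, forall k, (K <= k)%N -> forall v, voter eta0 w k v = true >].

(* All the random variables below take values in a set D with the discrete
   sigma-algebra. *)

Definition discrete_rv (d : measure_display) (T : measurableType d) (D : Type)
    (X : T -> D) : Prop :=
  forall B : set D, measurable (X @^-1` B).

Definition rv_events (T D : Type) (X : T -> D) : set (set T) :=
  preimage_set_system setT X [set: set D].

Definition process_events (T I D : Type) (J : set I) (X : I -> T -> D) :
    set (set T) :=
  \bigcup_(i in J) rv_events (X i).

Definition mutually_independent (R : realType) (d : measure_display)
    (T : measurableType d) (P : probability T R) (I : eqType)
    (F : I -> set (set T)) : Prop :=
  forall (J : seq I) (A : I -> set T), uniq J ->
    (forall i, i \in J -> F i (A i)) ->
    P (\bigcap_(i in [set` J]) A i) = (\prod_(i <- J) P (A i))%E.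

Definition independent (R : realType) (d : measure_display)
    (T : measurableType d) (P : probability T R) (F G : set (set T)) : Prop :=
  forall A B, F A -> G B -> P (A `&` B) = (P A * P B)%E.

Definition iid (R : realType) (d : measure_display) (T : measurableType d)
    (P : probability T R) (I : eqType) (D : Type) (pmf : D -> R)
    (X : I -> T -> D) : Prop :=
  [/\ forall i, discrete_rv (X i),
      forall i a, P [set x | X i x = a] = (pmf a)%:E
    & mutually_independent P (fun i => rv_events (X i))].

(* Values at negative times are irrelevant in all that follows. *)

(* Poisson process of rate one.  The subtraction on nat is harmless since the
   paths are almost surely nondecreasing. *)
Definition poisson_process (R : realType) (d : measure_display)
    (T : measurableType d) (P : probability T R) (N : R -> T -> nat) : Prop :=
  [/\ forall s : R, 0 <= s -> discrete_rv (N s),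
      {ae P, forall x, [/\ N 0 x = 0%N,
         forall s u : R, 0 <= s <= u -> (N s x <= N u x)%N
       & forall s : R, 0 <= s -> \forall u \near s^'+, N u x = N s x]},
      forall s u : R, 0 <= s < u -> forall j,
        P [set x | (N u x - N s x)%N = j] = (poisson_pmf (u - s) j)%:E
    & forall ts : nat -> R, 0 <= ts 0%N -> 
        {homo ts : i j / (i <= j)%N >-> i <= j} ->
        mutually_independent P
          (fun i => rv_events (fun x => (N (ts i.+1) x - N (ts i) x)%N))].

(* s > 0 is a jump time of the counting path c. *)
Definition rings (R : realType) (c : R -> nat) (s : R) : Prop :=
  forall u : R, 0 <= u < s -> (c u < c s)%N.

(* z s i is the value at position i at time s.  The clock c k is attached to
   the pair of positions (k, k+1): z is right-continuous with left limits
   zl = z (s-), the values at k and k+1 are swapped when the clock c k rings,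
   and nothing else changes. *)
Definition interchange_path (R : realType) (c : nat -> R -> nat)
    (z : R -> nat -> nat) : Prop :=
  [/\ forall i, z 0 i = i,
      forall s : R, 0 <= s -> forall i, \forall u \near s^'+, z u i = z s i
    & forall s : R, 0 < s -> exists zl : nat -> nat,
      [/\ forall i, \forall u \near s^'-, z u i = zl i,
          forall k, rings (c k) s -> z s k = zl k.+1 /\ z s k.+1 = zl k
        & forall i, ~ rings (c i) s ->
            (forall k, i = k.+1 -> ~ rings (c k) s) -> z s i = zl i]].

(* The interchange process, by its graphical construction from independent
   rate one Poisson clocks.  Almost surely no two clocks ring
   simultaneously. *)
Definition interchange_process (R : realType) (d : measure_display)
    (T : measurableType d) (P : probability T R) (zeta : R -> nat -> T -> nat) :
    Prop :=
  (forall (s : R) i, 0 <= s -> discrete_rv (zeta s i)) /\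
  exists N : nat -> R -> T -> nat,
    [/\ forall k, poisson_process P (N k),
        mutually_independent P
          (fun k => <<s process_events [set s | 0 <= s] (N k) >>)
      & {ae P, forall x,
          interchange_path (fun k s => N k s x) (fun s i => zeta s i x)}].

(* Events generated by zeta_s(i), for all s >= 0 and all positions i. *)
Definition interchange_events (R : realType) (T : Type)
    (zeta : R -> nat -> T -> nat) : set (set T) :=
  process_events [set si : R * nat | 0 <= si.1] (fun si => zeta si.1 si.2).

(* Main.v *)
(* Reading the edges in the order given by the interchange process at any fixed
   time leaves their joint law unchanged, so it suffices to bound, summed over
   k, the influence on the opinions at time K of swapping the edges k and k+1;
   this is multiplied by t.  Such a swap matters only if the two edges overlap
   and one of them is discordant, which given the current opinions eta has
   probability O(Delta B / N^2), with B the number of discordant directed edges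
   and N the number of directed edges.  The number of vertices where two
   configurations driven by the same edges disagree is a martingale, so a swap
   changes a final consensus with probability at most O(Delta B / N^2) / n.
   Finally M (n - M), where M is the number of ones, decreases in the mean by
   B / N at each step and is at most n^2 / 4, so the expected values of B at the
   steps 0, 1, ... sum to at most N n^2 / 4.  This also yields almost sure
   consensus. *)

Require Import Defs.
From HB Require Import structures.
From mathcomp Require Import all_boot all_order all_algebra.
From mathcomp Require Import all_classical all_reals all_analysis.
From mathcomp Require Import ring lra zify.
Set Implicit Arguments.
Unset Strict Implicit.
Unset Printing Implicit Defensive.
Import Order.TTheory GRing.Theory Num.Theory.
Import numFieldNormedType.Exports.
Local Open Scope classical_set_scope.
Local Open Scope ring_scope.

(** * Voter dynamics driven by uniform edges *)

(** Almost surely infinitely many clocks ring in every time interval, so the path has no first jump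
    and cannot be followed swap by swap. Hence a horizon [K] and a grid of [m.+1] cells of length h:
    outside an event of order h^2, on which the clocks 0, ..., K ring twice in one cell, a cell
    changes the first [K] labels by at most one transposition. For fixed [K] these errors sum to
    O(1/m); then [K] grows.

    Independence is assumed for [zeta], not for its clocks. That a given swap occurred is therefore
    expressed as an event about the labels, and the clocks bound its probability. Distinctness of
    the labels, on which the law of the edges read off depends, is not part of the definition of a
    path either: it is deduced from the almost sure presence of a silent clock.

    It matters only before consensus, hence with probability O(1/K).

    With Delta the maximum degree, the constant is (8 Delta / N^2) (N n^2 / 4) / n = 2 n Delta / N,
    and N is at least the number of edges. *)

Section VoterCombinatorics.
Variables (R : realType) (V : finType) (e : rel V).
Local Notation DE := (directed_edge e).
Local Notation N := (#|DE|%:R : R).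
Implicit Types (eta : V -> bool) (f : DE) (w : nat -> DE).

(** The value type is arbitrary so that a step also acts on real functions on the vertices, such as
    the indicator of disagreement. *)
Definition voter_step (A : Type) f (g : V -> A) : V -> A :=
  fun z => if z == (val f).2 then g (val f).1 else g z.

(** The Markov operator of the chain: [iter k voter_op F eta] is the mean of [F] after [k] steps
    from [eta]. *)
Definition voter_op (g : (V -> bool) -> R) eta : R :=
  N^-1 * \sum_(f : DE) g (voter_step f eta).

(** Expectation over [L] independent uniform edges as nested finite averages, so that conditioning
    on the first edge is mere computation and this section needs no measure theory. *)
Fixpoint edge_mean (L : nat) (G : seq DE -> R) : R :=
  if L is L'.+1 then N^-1 * \sum_(f : DE) edge_mean L' (fun s => G (f :: s))
  else G [::].

Definition disagreement eta1 eta2 : R := \sum_v (eta1 v != eta2 v)%:R.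
Definition discordance eta : R :=
  \sum_(f : DE) (eta (val f).1 != eta (val f).2)%:R.
Definition non_consensus eta : bool := [exists x, exists y, eta x != eta y].
Definition ones eta : R := \sum_v (eta v)%:R.
Definition ones_zeros eta : R := ones eta * (#|V|%:R - ones eta).

(** [voter] unfolds at its last step, whereas [edge_mean] and [voter_op] condition on the first
    one. *)
Lemma voter_shift eta w k :
  voter eta w k.+1 = voter (voter_step (w 0) eta) (w \o succn) k.
Proof.
elim: k => [//|k IH]; apply: funext => z.
transitivity (voter_step (w k.+1) (voter eta w k.+1) z) => //.
by rewrite IH.
Qed.

Lemma sum_dir_edge (F : V -> V -> R) :
  \sum_(f : DE) F (val f).1 (val f).2 = \sum_x \sum_(y | e x y) F x y.
Proof.
rewrite pair_big_dep /=.
rewrite (reindex_omap (val : DE -> V * V) insub) /=; last first.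
  by move=> [x y] /= exy; rewrite insubT.
apply: eq_bigl => f; rewrite valK eqxx andbT.
by rewrite (valP f).
Qed.

Lemma edge_meanS L (G : seq DE -> R) :
  edge_mean L.+1 G = N^-1 * \sum_(f : DE) edge_mean L (fun s => G (f :: s)).
Proof. by []. Qed.

Hypothesis he : simple_graph e.

(** Reversing a directed edge is a bijection. This symmetry is the source of both martingales, the
    number of disagreements and the number of ones. *)
Lemma sum_dir_edge_sym (F : V -> V -> R) :
  \sum_(f : DE) F (val f).1 (val f).2 = \sum_(f : DE) F (val f).2 (val f).1.
Proof.
rewrite sum_dir_edge (sum_dir_edge (fun x y => F y x)).
rewrite (exchange_big_dep predT) //=.
by apply: eq_bigr => x _; apply: eq_bigl => y; rewrite (proj1 he).
Qed.

Lemma sum_voter_step f (g : V -> R) :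
  \sum_v voter_step f g v = \sum_v g v + g (val f).1 - g (val f).2.
Proof.
rewrite (bigD1 (val f).2) //= (bigD1 (val f).2 (P := predT)) //=.
rewrite {1}/voter_step eqxx.
have -> : \sum_(i | i != (val f).2) voter_step f g i =
    \sum_(i | i != (val f).2) g i.
  by apply: eq_bigr => i /negPf; rewrite /voter_step => ->.
ring.
Qed.

Lemma disagreement_stepE f eta1 eta2 :
  disagreement (voter_step f eta1) (voter_step f eta2) =
  disagreement eta1 eta2 + (eta1 (val f).1 != eta2 (val f).1)%:R
     - (eta1 (val f).2 != eta2 (val f).2)%:R.
Proof.
rewrite /disagreement -(sum_voter_step f (fun v => (eta1 v != eta2 v)%:R)).
by apply: eq_bigr => v _; rewrite /voter_step; case: ifP.
Qed.

Hypothesis N_gt0 : (0 < #|DE|)%N.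

Lemma N_neq0 : N != 0. Proof. by rewrite pnatr_eq0 -lt0n. Qed.

Lemma mean_cst (c : R) : N^-1 * \sum_(f : DE) c = c.
Proof. by rewrite sumr_const -[c *+ _]mulr_natl mulKf ?N_neq0. Qed.

Lemma mean_disagreement eta1 eta2 :
  N^-1 * \sum_(f : DE) disagreement (voter_step f eta1) (voter_step f eta2) =
  disagreement eta1 eta2.
Proof.
under eq_bigr do rewrite disagreement_stepE.
rewrite sumrB big_split /=.
rewrite (sum_dir_edge_sym (fun x y => (eta1 x != eta2 x)%:R)).
by rewrite addrK mean_cst.
Qed.

Lemma ler_mean (F G : DE -> R) :
  (forall f, F f <= G f) -> N^-1 * \sum_(f : DE) F f <= N^-1 * \sum_(f : DE) G f.
Proof. by move=> FG; rewrite ler_wpM2l ?invr_ge0// ler_sum. Qed.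

Lemma edge_mean_le L (F G : seq DE -> R) :
  (forall s, size s = L -> F s <= G s) -> edge_mean L F <= edge_mean L G.
Proof.
elim: L F G => [|L IH] F G FG /=; first exact: FG.
by apply: ler_mean => f; apply: IH => s sL; apply: FG; rewrite /= sL.
Qed.

Lemma edge_mean_eq L (F G : seq DE -> R) :
  (forall s, size s = L -> F s = G s) -> edge_mean L F = edge_mean L G.
Proof.
by move=> FG; apply: le_anti; rewrite !edge_mean_le// => s /FG ->.
Qed.

Lemma edge_mean_sum L (I : Type) (r : seq I) (P : pred I)
    (F : I -> seq DE -> R) :
  edge_mean L (fun s => \sum_(i <- r | P i) F i s) =
  \sum_(i <- r | P i) edge_mean L (F i).
Proof.
elim: L F => [//|L IH] F /=.
under eq_bigr do rewrite IH.
by rewrite exchange_big mulr_sumr.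
Qed.

Lemma edge_mean_cst L (c : R) : edge_mean L (fun=> c) = c.
Proof. by elim: L => [//|L IH] /=; rewrite IH mean_cst. Qed.

Lemma edge_mean_ge0 L (F : seq DE -> R) : (forall s, 0 <= F s) -> 0 <= edge_mean L F.
Proof. by move=> F0; rewrite -(edge_mean_cst L 0); apply: edge_mean_le. Qed.

Lemma edge_mean_voter (f0 : DE) (F : (V -> bool) -> R) L K eta :
  (K <= L)%N ->
  edge_mean L (fun s => F (voter eta (nth f0 s) K)) = iter K voter_op F eta.
Proof.
elim: K L eta => [|K IH] L eta KL; first exact: (edge_mean_cst L (F eta)).
case: L KL => [//|L] KL; rewrite iterS [LHS]/= /voter_op; congr (_ * _).
apply: eq_bigr => f _.
rewrite -(IH L)//; apply: edge_mean_eq => s _.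
by rewrite -/(voter eta (nth f0 (f :: s)) K.+1) voter_shift.
Qed.

Lemma edge_mean_disagreement (f0 : DE) L K eta1 eta2 : (K <= L)%N ->
  edge_mean L (fun s => disagreement (voter eta1 (nth f0 s) K)
                                     (voter eta2 (nth f0 s) K)) =
  disagreement eta1 eta2.
Proof.
elim: K L eta1 eta2 => [|K IH] L eta1 eta2 KL; first
  exact: (edge_mean_cst L (disagreement eta1 eta2)).
case: L KL => [//|L] KL; rewrite -[RHS]mean_disagreement /=; congr (_ * _).
apply: eq_bigr => f _.
rewrite -(IH L)//; apply: edge_mean_eq => s _.
by rewrite -/(voter eta1 (nth f0 (f :: s)) K.+1)
  -/(voter eta2 (nth f0 (f :: s)) K.+1) !voter_shift.
Qed.

Lemma voter_op_le (F G : (V -> bool) -> R) :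
  (forall eta, F eta <= G eta) -> forall eta, voter_op F eta <= voter_op G eta.
Proof. by move=> FG eta; apply: ler_mean. Qed.

Lemma iter_voter_op_le k (F G : (V -> bool) -> R) :
  (forall eta, F eta <= G eta) ->
  forall eta, iter k voter_op F eta <= iter k voter_op G eta.
Proof. by elim: k => [//|k IH] FG eta /=; apply: voter_op_le => ?; exact: IH. Qed.

Lemma iter_voter_opZ k (c : R) (F : (V -> bool) -> R) eta :
  iter k voter_op (fun eta => c * F eta) eta = c * iter k voter_op F eta.
Proof.
elim: k eta => [//|k IH] eta /=; rewrite /voter_op mulrCA; congr (_ * _).
by rewrite mulr_sumr; apply: eq_bigr => f _; rewrite IH.
Qed.

Lemma iter_voter_opB k (F G : (V -> bool) -> R) eta :
  iter k voter_op (fun eta => F eta - G eta) eta =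
  iter k voter_op F eta - iter k voter_op G eta.
Proof.
elim: k eta => [//|k IH] eta /=; rewrite /voter_op -mulrBr; congr (_ * _).
by rewrite -sumrB; apply: eq_bigr => f _; rewrite IH.
Qed.

Lemma iter_voter_op_cst k (c : R) eta : iter k voter_op (fun=> c) eta = c.
Proof.
elim: k eta => [//|k IH] eta /=; rewrite /voter_op.
by under eq_bigr do rewrite IH; rewrite mean_cst.
Qed.

(** * Quadratic drift of the number of ones and decay of non-consensus *)

Lemma ones_ge0 eta : 0 <= ones eta.
Proof. by apply: sumr_ge0 => v _; rewrite ler0n. Qed.

Lemma ones_le eta : ones eta <= #|V|%:R.
Proof.
rewrite -[#|V|%:R](sumr_const V (1 : R)).
by apply: ler_sum => v _; case: (eta v).
Qed.

(* The number M of ones is a martingale with increments in {-1, 0, 1}, so M^2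
   grows in the mean by the probability that M moves. *)
Lemma voter_op_ones_zeros eta :
  voter_op ones_zeros eta = ones_zeros eta - N^-1 * discordance eta.
Proof.
rewrite /voter_op /discordance.
have H f : ones_zeros (voter_step f eta) = ones_zeros eta
   + (#|V|%:R - 2 * ones eta) * (eta (val f).1)%:R
   - (#|V|%:R - 2 * ones eta) * (eta (val f).2)%:R
   - (eta (val f).1 != eta (val f).2)%:R.
  have -> : ones_zeros (voter_step f eta) =
    (ones eta + (eta (val f).1)%:R - (eta (val f).2)%:R) *
    (#|V|%:R - (ones eta + (eta (val f).1)%:R - (eta (val f).2)%:R)).
    rewrite /ones_zeros; have -> // : ones (voter_step f eta) =
      ones eta + (eta (val f).1)%:R - (eta (val f).2)%:R.
    rewrite /ones -(sum_voter_step f (fun v => (eta v)%:R)).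
    by apply: eq_bigr => v _; rewrite /voter_step; case: ifP.
  rewrite /ones_zeros.
  by case: (eta (val f).1); case: (eta (val f).2) => /=; ring.
under eq_bigr do rewrite H.
rewrite sumrB sumrB big_split /=.
rewrite (sum_dir_edge_sym (fun x y => _ * (eta x)%:R)) addrK.
by rewrite mulrBr mean_cst.
Qed.

Lemma ones_zeros_ge0 eta : 0 <= ones_zeros eta.
Proof. by rewrite mulr_ge0 ?ones_ge0// subr_ge0 ones_le. Qed.

Lemma ones_zeros_le eta : ones_zeros eta <= #|V|%:R ^+ 2 / 4.
Proof.
rewrite /ones_zeros; have := sqr_ge0 (#|V|%:R - 2 * ones eta); nra.
Qed.

Lemma sum_iter_discordance L eta :
  \sum_(k < L) iter k voter_op discordance eta <= N * (#|V|%:R ^+ 2 / 4).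
Proof.
have E k : iter k voter_op discordance eta =
    N * (iter k voter_op ones_zeros eta - iter k.+1 voter_op ones_zeros eta).
  rewrite iterSr -iter_voter_opB -iter_voter_opZ; congr (iter _ _ _ _).
  apply: funext => z; rewrite voter_op_ones_zeros opprB addrC subrK.
  by rewrite mulrA divff ?N_neq0 ?mul1r.
under eq_bigr do rewrite E.
rewrite -mulr_sumr ler_wpM2l//.
rewrite -(big_mkord predT (fun k => iter k voter_op ones_zeros eta -
   iter k.+1 voter_op ones_zeros eta)) /=.
rewrite (telescope_sumr_eq (fun k => - iter k voter_op ones_zeros eta))//=;
  last by move=> k _; rewrite opprK addrC.
rewrite opprK addrC.
apply: le_trans (ones_zeros_le eta); rewrite gerBl.
rewrite -(iter_voter_op_cst L 0 eta).
by apply: iter_voter_op_le; exact: ones_zeros_ge0.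
Qed.

Hypothesis hc : connected_graph e.

(** If no edge is discordant, the set of ones is closed under [e], and connectedness makes [eta]
    constant. *)
Lemma non_consensus_discordance eta :
  (non_consensus eta)%:R <= discordance eta.
Proof.
case: (boolP (non_consensus eta)) => [/existsP[x /existsP[y xy]]|_]; last first.
  by apply: sumr_ge0.
have [f ff|H] := pickP (fun f : DE => eta (val f).1 != eta (val f).2).
  rewrite /discordance (bigD1 f)//= ff lerDl sumr_ge0//.
have cl : closed_mem e (mem eta).
  move=> u v uv; have := H (exist _ (u, v) uv) => /= /negbFE/eqP.
  by rewrite unfold_in.
have := closed_connect cl (hc x y); rewrite !unfold_in => E.
by rewrite E eqxx in xy.
Qed.

Lemma non_consensus_step f eta :
  non_consensus (voter_step f eta) -> non_consensus eta.
Proof.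
move=> /existsP[x /existsP[y]]; rewrite /voter_step.
by do 2 case: ifP => _; move=> H;
  apply/existsP; eexists; apply/existsP; eexists; exact: H.
Qed.

(** Consensus is absorbing, so the probability of non-consensus decreases in time, and [L] times its
    value at [L] is at most its sum over the earlier steps. That sum is controlled by the total
    discordance. *)
Lemma iter_non_consensus L eta :
  L%:R * iter L voter_op (fun eta => (non_consensus eta)%:R) eta <=
  N * (#|V|%:R ^+ 2 / 4).
Proof.
set u := fun k => iter k voter_op (fun eta => (non_consensus eta)%:R) eta.
have uS k : u k.+1 <= u k.
  rewrite /u iterSr; apply: iter_voter_op_le => z.
  rewrite -[X in _ <= X]mean_cst; apply: ler_mean => f.
  by rewrite ler_nat; case: (boolP (non_consensus (voter_step f z))) =>
    [/non_consensus_step ->|].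
have uL k l : (k <= l)%N -> u l <= u k.
  by elim: l => [|l IH]; [rewrite leqn0 => /eqP ->|
    rewrite leq_eqVlt => /predU1P[->//|/IH]; exact: le_trans].
apply: le_trans (sum_iter_discordance L eta).
rewrite -/(u L) mulr_natl -[X in _ *+ X]card_ord -sumr_const.
apply: ler_sum => k _; apply: le_trans (uL k L _) _; first exact: ltnW.
exact/iter_voter_op_le/non_consensus_discordance.
Qed.


(** * Influence of exchanging two consecutive edges *)

Lemma in_degree_le (y : V) :
  \sum_(f : DE) ((val f).2 == y)%:R <= (max_degree e)%:R :> R.
Proof.
rewrite (sum_dir_edge (fun _ z => (z == y)%:R)).
rewrite (exchange_big_dep predT) //= (bigD1 y) //=.
rewrite [X in _ + X]big1 ?addr0; last first.
  by move=> z /negPf zy; apply: big1 => x _; rewrite zy.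
rewrite eqxx sumr_const ler_nat.
apply: leq_trans (leq_bigmax y); rewrite -sum1_card -sum1_card.
by apply: eq_leq; apply: eq_bigl => x; rewrite inE (proj1 he).
Qed.

Lemma out_degree_le (x : V) :
  \sum_(f : DE) ((val f).1 == x)%:R <= (max_degree e)%:R :> R.
Proof. by rewrite (sum_dir_edge_sym (fun z _ => (z == x)%:R)) in_degree_le. Qed.

Lemma sum_pred1 (y : V) : \sum_z (z == y)%:R = 1 :> R.
Proof. by rewrite (bigD1 y)//= eqxx big1 ?addr0// => z /negPf ->. Qed.

(** The order matters only if the head of one edge is an endpoint of the other. Each term of the
    bound asks that the edge whose head is shared be discordant, since otherwise using it changes
    nothing. *)
Lemma disagreement_commute_le f1 f2 eta :
  disagreement (voter_step f2 (voter_step f1 eta))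
               (voter_step f1 (voter_step f2 eta)) <=
  2 * (((val f2).2 == (val f1).2)%:R + ((val f2).1 == (val f1).2)%:R)
    * (eta (val f1).1 != eta (val f1).2)%:R +
  2 * (((val f1).2 == (val f2).2)%:R + ((val f1).1 == (val f2).2)%:R)
    * (eta (val f2).1 != eta (val f2).2)%:R.
Proof.
set c := (X in _ <= X).
have c_ge0 : 0 <= c by rewrite /c; do !apply: addr_ge0 || apply: mulr_ge0 => //.
have irr f : (val f).1 != (val f).2.
  by apply/negP => /eqP E; have := valP f; rewrite E (proj2 he).
(* Half of [c] is charged to each of the two heads, the only vertices where the two orders can
   differ; coinciding heads receive both halves. *)
have -> : c = \sum_z ((z == (val f1).2)%:R + (z == (val f2).2)%:R) * (c / 2).
  rewrite -mulr_suml big_split /=.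
  by rewrite !sum_pred1; field.
apply: ler_sum => z _; move: (irr f1) (irr f2); rewrite /c /voter_step {c c_ge0}.
case: f1 f2 => [[x y] /= _] [[x' y'] /= _].
case: (eqVneq z y) => [<-{y}|zy]; case: (eqVneq z y') => [<-{y'}|zy'] /=.
- move=> xz x'z; rewrite (negPf xz) (negPf x'z).
  by case: (eta x); case: (eta x'); case: (eta z) => /=; lra.
- move=> _ _; case: (eqVneq x y') => [->|_] /=; last first.
    by rewrite eqxx !mulr_ge0 ?addr_ge0 ?mulr_ge0 ?addr_ge0.
  by case: (_ == z); case: (eta y'); case: (eta x'); case: (eta z) => /=; lra.
- move=> _ _; case: (eqVneq x' y) => [->|_] /=; last first.
    by rewrite eqxx !mulr_ge0 ?addr_ge0 ?mulr_ge0 ?addr_ge0.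
  by case: (_ == z); case: (z == _); case: (_ == z); case: (eta y); case: (eta x);
    case: (eta z) => /=; lra.
- by move=> _ _; rewrite eqxx addr0 mul0r.
Qed.

(** For a given [f1], at most [max_degree e] edges end at its head and as many start there; with the
    factor 2 of the pointwise bound this gives 4, and exchanging the roles of the two edges gives
    8. *)
Lemma mean_disagreement_commute eta :
  N^-1 * \sum_(f1 : DE) (N^-1 * \sum_(f2 : DE)
    disagreement (voter_step f2 (voter_step f1 eta))
                 (voter_step f1 (voter_step f2 eta))) <=
  8 * (max_degree e)%:R / N ^+ 2 * discordance eta.
Proof.
pose a (f1 f2 : DE) : R := 2 * (((val f2).2 == (val f1).2)%:R +
  ((val f2).1 == (val f1).2)%:R) * (eta (val f1).1 != eta (val f1).2)%:R.
have Ha : \sum_(f1 : DE) \sum_(f2 : DE) a f1 f2 <=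
    4 * (max_degree e)%:R * discordance eta.
  rewrite /discordance mulr_sumr; apply: ler_sum => f1 _.
  rewrite /a -mulr_suml ler_wpM2r// -mulr_sumr big_split /=.
  by have := in_degree_le (val f1).2; have := out_degree_le (val f1).2; lra.
rewrite -mulr_sumr [leLHS]mulrA.
have -> : 8 * (max_degree e)%:R / N ^+ 2 * discordance eta =
    N^-1 * N^-1 * (8 * (max_degree e)%:R * discordance eta).
  by field; exact: N_neq0.
rewrite ler_wpM2l ?mulr_ge0 ?invr_ge0//.
apply: (@le_trans _ _ (\sum_(f1 : DE) \sum_(f2 : DE) (a f1 f2 + a f2 f1))).
  by do 2 (apply: ler_sum => ? _); exact: disagreement_commute_le.
under eq_bigr do rewrite big_split.
by rewrite big_split /= [X in _ + X]exchange_big; lra.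
Qed.

Definition swap_at (k j : nat) : nat :=
  if j == k then k.+1 else if j == k.+1 then k else j.

Lemma voter_ext eta w w' k : (forall j, (j < k)%N -> w j = w' j) ->
  voter eta w k = voter eta w' k.
Proof.
elim: k => [//|k IH] ww'; apply: funext => z /=.
by rewrite ww'// IH// => j jk; apply: ww'; rewrite ltnS ltnW.
Qed.

Lemma voter_swap_shift eta w k K :
  voter eta (w \o swap_at k.+1) K.+1 =
  voter (voter_step (w 0) eta) ((w \o succn) \o swap_at k) K.
Proof.
rewrite voter_shift; congr voter; apply: funext => j /=.
by rewrite /swap_at !eqSS; case: ifP => // _; case: ifP.
Qed.

(** The mean number of vertices whose opinion at time [K] changes under the swap. There are [K.+1]
    edges, one more than time [K] uses, because the swap at [k = K - 1] brings in the edge of index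
    [K]. *)
Definition swap_effect (f0 : DE) (k K : nat) eta : R :=
  edge_mean K.+1 (fun s => disagreement (voter eta (nth f0 s) K)
                                  (voter eta (nth f0 s \o swap_at k) K)).

Lemma swap_effectS (f0 : DE) k K eta :
  swap_effect f0 k.+1 K.+1 eta = voter_op (swap_effect f0 k K) eta.
Proof.
rewrite /swap_effect edge_meanS /voter_op; congr (_ * _).
apply: eq_bigr => f _; apply: edge_mean_eq => s _.
by rewrite (voter_swap_shift _ (nth f0 (f :: s))) voter_shift.
Qed.

(** The first [k] steps are common to both runs and contribute iterates of [voter_op]; the condition
    on [k] says that both exchanged edges are used before time [K]. *)
Lemma swap_effect_le (f0 : DE) k K eta : (k.+1 < K)%N ->
  swap_effect f0 k K eta <=
  8 * (max_degree e)%:R / N ^+ 2 * iter k voter_op discordance eta.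
Proof.
elim: k K eta => [|k IH] K eta kK; last first.
  case: K kK => [//|K] kK; rewrite swap_effectS iterS.
  rewrite {2}/voter_op mulrCA mulr_sumr /voter_op.
  by apply: ler_mean => f; exact: IH.
case: K kK => [//|[//|K]] _; apply: le_trans (mean_disagreement_commute eta).
rewrite /swap_effect edge_meanS; apply: ler_mean => f1.
rewrite edge_meanS; apply: ler_mean => f2.
(* After the two exchanged steps both runs use the same edges, so the mean disagreement no longer
   changes. *)
rewrite -(edge_mean_disagreement f0 _ _ (leqnSn K)).
rewrite le_eqVlt; apply/predU1P; left; apply: edge_mean_eq => s _.
by rewrite !voter_shift; congr disagreement;
  congr voter.
Qed.

(** The boundary swap replaces the last edge used by a fresh one. The results can differ only at the
    two heads, whence the factor 2, and not at all once consensus holds. *)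
Lemma swap_effect_last (f0 : DE) k eta :
  swap_effect f0 k k.+1 eta <=
  2 * iter k voter_op (fun eta => (non_consensus eta)%:R) eta.
Proof.
elim: k eta => [|k IH] eta; last first.
  rewrite swap_effectS iterS {2}/voter_op mulrCA mulr_sumr /voter_op.
  by apply: ler_mean => f; exact: IH.
rewrite /swap_effect -[X in _ <= X](edge_mean_cst 2).
apply: edge_mean_le => -[//|f1 [//|f2 s]] _.
rewrite !voter_shift /=.
set g1 := voter_step f1 eta; set g2 := voter_step f2 eta.
case: (boolP (non_consensus eta)) => [_|nc]; last first.
  rewrite mulr0 /disagreement big1// => z _; move: nc.
  rewrite negb_exists => /forallP nc.
  have E x y : eta x = eta y.
    by have := nc x; rewrite negb_exists => /forallP/(_ y); rewrite negbK => /eqP.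
  rewrite /g1 /g2 /voter_step (_ : (_ == _) = true)//; apply/eqP.
  by do 2 case: ifP => _; exact: E.
have -> : 2 * true%:R = \sum_(z : V) ((z == (val f1).2)%:R + (z == (val f2).2)%:R) :> R.
  by rewrite big_split /= !sum_pred1; ring.
apply: ler_sum => z _; rewrite /g1 /g2 /voter_step.
case: (z == (val f1).2); case: (z == (val f2).2); last by rewrite eqxx addr0.
all: by case: (_ != _); rewrite /= ?mulr1n ?mulr0n; lra.
Qed.

(** The main term is 8 / N^2 times the total discordance N n^2 / 4, with the maximum degree as a
    factor; the other term is the boundary swap. *)
Lemma sum_swap_effect (f0 : DE) K eta :
  \sum_(k < K.+2) swap_effect f0 k K.+2 eta <=
  2 * (max_degree e)%:R * #|V|%:R ^+ 2 / N
  + 2 * (N * (#|V|%:R ^+ 2 / 4)) / K.+1%:R.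
Proof.
rewrite big_ord_recr /=; apply: lerD.
  apply: (@le_trans _ _ (8 * (max_degree e)%:R / N ^+ 2 *
      \sum_(k < K.+1) iter k voter_op discordance eta)).
    rewrite mulr_sumr; apply: ler_sum => k _.
    by apply: swap_effect_le; rewrite ltnS ltn_ord.
  apply: (@le_trans _ _ (8 * (max_degree e)%:R / N ^+ 2 *
      (N * (#|V|%:R ^+ 2 / 4)))); last first.
    by rewrite le_eqVlt; apply/predU1P; left; field; exact: N_neq0.
  by rewrite ler_wpM2l ?mulr_ge0 ?invr_ge0 ?exprn_ge0// sum_iter_discordance.
apply: le_trans (swap_effect_last f0 K.+1 eta) _.
rewrite -mulrA ler_wpM2l// ler_pdivlMr ?ltr0n// mulrC.
exact: iter_non_consensus.
Qed.

Lemma card_edges_le : (#|edges e| <= #|DE|)%N.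
Proof.
apply: leq_trans (leq_imset_card (fun f : DE => [set (val f).1; (val f).2]%SET) DE).
apply/subset_leq_card/fintype.subsetP => A; rewrite inE.
move=> /existsP[x /existsP[y /andP[xy /eqP ->]]].
by apply/imsetP; exists (exist _ (x, y) xy).
Qed.

End VoterCombinatorics.

(** * Deterministic paths of the interchange process *)

Section InterchangePaths.
Variable R : realType.
Implicit Types (a b s u v : R).

Lemma near_right_itv s (Q : R -> Prop) : (\forall u \near s^'+, Q u) ->
  exists2 r, s < r & forall u, s < u < r -> Q u.
Proof.
move=> /nbhs_ballP[d /= d0 H]; exists (s + d); first by rewrite ltrDl.
move=> u /andP[su ur]; apply: H => //=.
by rewrite /ball /= ltr_distlC; apply/andP; split; lra.
Qed.

Lemma near_left_itv s (Q : R -> Prop) : (\forall u \near s^'-, Q u) ->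
  exists2 r, r < s & forall u, r < u < s -> Q u.
Proof.
move=> /nbhs_ballP[d /= d0 H]; exists (s - d); first by rewrite ltrBlDr ltrDl.
move=> u /andP[su ur]; apply: H => //=.
by rewrite /ball /= ltr_distlC; apply/andP; split; lra.
Qed.

Lemma between_right s r b : s < r -> s < b -> exists u, [/\ s < u, u < r & u < b].
Proof.
move=> sr sb; have H : s < Num.min r b by rewrite lt_min sr.
exists ((s + Num.min r b) / 2); have [H1 H2] := midf_lt H.
by split => //; rewrite (lt_le_trans H2)// ge_min lexx ?orbT.
Qed.

Lemma between_left s r a : r < s -> a < s -> exists u, [/\ u < s, r < u & a < u].
Proof.
move=> rs as_; have H : Num.max r a < s by rewrite gt_max rs.
exists ((Num.max r a + s) / 2); have [H1 H2] := midf_lt H.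
by split => //; rewrite (le_lt_trans _ H1)// le_max lexx ?orbT.
Qed.

(** Continuity induction, on the supremum of the times up to which [g] keeps its value at [a]. It
    turns the local description of a path into a statement about a whole interval. *)
Lemma locally_constant_itv (g : R -> nat) a b : a <= b ->
  (forall s, a <= s < b -> exists2 r, s < r & forall u, s < u < r -> g u = g s) ->
  (forall s, a < s <= b -> exists2 r, r < s & forall u, r < u < s -> g u = g s) ->
  g b = g a.
Proof.
move=> ab hr hl.
pose E := [set u | a <= u <= b /\ forall v, a <= v <= u -> g v = g a].
have Ea : E a.
  by split; [rewrite lexx|move=> v vaa; congr g; apply: le_anti; rewrite andbC].
have Eub : ubound E b by move=> u [/andP[]].
have hE : has_sup E by split; [exists a|exists b].
set s := sup E.
have as_ : a <= s by apply: ub_le_sup => //; exists b.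
have sb : s <= b by apply: ge_sup => //; exists a.
have Elt v : a <= v < s -> g v = g a.
  move=> /andP[av vs].
  have [|u [_ Eu] su] := @sup_adherent _ E (s - v) _ hE; first by rewrite subr_gt0.
  by apply: Eu; rewrite av /=; rewrite -/s subKr in su; exact: ltW.
have Es : g s = g a.
  have := as_; rewrite le_eqVlt => /predU1P[-> //|lt_as].
  have [|r rs H] := hl s; first by rewrite lt_as.
  have [u [us ru au]] := between_left rs lt_as.
  by rewrite -(H u) ?ru//; apply: Elt; rewrite us ltW.
have := sb; rewrite le_eqVlt => /predU1P[<- //|lt_sb].
have [|r sr H] := hr s; first by rewrite as_.
have [u [su ur ub]] := between_right sr lt_sb.
suff /(ub_le_sup (ex_intro _ b Eub)) : E u by rewrite leNgt su.
split; first by rewrite (ltW ub) (le_trans as_ (ltW su)).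
move=> v /andP[av vu]; case: (ltgtP v s) => [vs|sv|->//].
  by apply: Elt; rewrite av vs.
by rewrite H// sv (le_lt_trans vu).
Qed.

(** The properties of a Poisson path that the deterministic arguments use. *)
Definition counting_path (c : R -> nat) : Prop :=
  (forall s u, 0 <= s <= u -> (c s <= c u)%N) /\
  (forall s, 0 <= s -> \forall u \near s^'+, c u = c s).

Lemma no_ring (c : R -> nat) a b s : counting_path c -> 0 <= a -> c b = c a ->
  a < s <= b -> ~ rings c s.
Proof.
move=> [mono _] a0 cab /andP[as_ sb] /(_ a); rewrite a0 as_ => /(_ isT).
by rewrite ltnNge -cab mono// sb andbT (le_trans a0 (ltW as_)).
Qed.

(** The ring time is the supremum of the times at which the count is still [c a]; right-continuity
    shows that the jump has already happened there. *)
Lemma single_ring (c : R -> nat) a b : counting_path c -> 0 <= a <= b ->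
  c b = (c a).+1 -> exists s, [/\ a < s <= b, rings c s, c s = c b &
    forall u, a <= u < s -> c u = c a].
Proof.
move=> [mono rc] /andP[a0 ab] cab.
pose E := [set u | a <= u <= b /\ c u = c a].
have Ea : E a by split; rewrite ?lexx.
have Eub : ubound E b by move=> u [/andP[]].
have hE : has_sup E by split; [exists a|exists b].
set s := sup E.
have as_ : a <= s by apply: ub_le_sup => //; exists b.
have sb : s <= b by apply: ge_sup => //; exists a.
have Elt v : a <= v < s -> c v = c a.
  move=> /andP[av vs].
  have [|u [/andP[au ub] Eu] su] := @sup_adherent _ E (s - v) _ hE.
    by rewrite subr_gt0.
  rewrite -/s subKr in su; apply/eqP; rewrite eqn_leq -{1}Eu !mono ?a0 ?av//.
  by rewrite (le_trans a0 av) ltW.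
have Es : c s != c a.
  apply/eqP => Es; have lt_sb : s < b.
    by rewrite lt_neqAle sb andbT; apply/eqP => E0; move: Es; rewrite E0; lia.
  have [r sr H] := near_right_itv (rc s (le_trans a0 as_)).
  have [u [su ur ub]] := between_right sr lt_sb.
  suff /(ub_le_sup (ex_intro _ b Eub)) : E u by rewrite leNgt su.
  split; first by rewrite (ltW ub) (le_trans as_ (ltW su)).
  by rewrite H ?su.
have lt_as : a < s.
  by rewrite lt_neqAle as_ andbT; apply: contra Es => /eqP <-.
have csb : c s = c b.
  have : (c a <= c s)%N by apply: mono; rewrite a0.
  have : (c s <= c b)%N by apply: mono; rewrite sb andbT (le_trans a0 as_).
  by move: Es; lia.
exists s; split => //; first by rewrite lt_as.
move=> u /andP[u0 us]; rewrite csb cab ltnS.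
case: (leP a u) => au; first by rewrite Elt// au.
by apply: mono; rewrite u0 ltW.
Qed.

(** * Change of the labels over one time cell *)

Section OneStep.
Variables (c : nat -> R -> nat) (z : R -> nat -> nat).
Hypothesis cP : forall k, counting_path (c k).
Hypothesis zP : interchange_path c z.
Variables (a b : R).
Hypothesis ab : 0 <= a <= b.

Lemma interchange_still i a' b' : 0 <= a' <= b' ->
  (forall s, a' < s <= b' -> ~ rings (c i) s) ->
  (forall k, i = k.+1 -> forall s, a' < s <= b' -> ~ rings (c k) s) ->
  z b' i = z a' i.
Proof.
move=> /andP[a0 a'b'] ni nk; have [_ zr zl] := zP.
apply: (locally_constant_itv (g := fun s => z s i)) => // s.
  by move=> /andP[as_ sb]; apply/near_right_itv/zr; exact: le_trans as_.
move=> /andP[as_ sb]; have [|zz [zzl _ H]] := zl s; first exact: le_lt_trans as_.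
have -> : z s i = zz i; first apply: H.
- by apply: ni; rewrite as_.
- by move=> k ik; apply: nk => //; rewrite as_.
exact: near_left_itv.
Qed.

(** The neighbouring clocks, which also act on these two positions, are silent. Both labels are thus
    still before and after the only ring, and the left limit at the ring is the value at [a]. *)
Lemma interchange_swap k : c k b = (c k a).+1 -> c k.+1 b = c k.+1 a ->
  (forall j, k = j.+1 -> c j b = c j a) ->
  z b k = z a k.+1 /\ z b k.+1 = z a k.
Proof.
move=> ck ck1 ckm; have /andP[a0 ab'] := ab.
have [s [/andP[as_ sb] rs csb cs]] := single_ring (cP k) ab ck.
have [_ zr zl] := zP.
have [|zz [zzl sw _]] := zl s; first exact: le_lt_trans as_.
have quiet a' b' : a <= a' <= b' -> b' <= b -> c k a' = c k b' ->
    z b' k = z a' k /\ z b' k.+1 = z a' k.+1.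
  move=> /andP[aa' a'b'] b'b ckE.
  have a'0 : 0 <= a' := le_trans a0 aa'.
  have nk v : a' < v <= b' -> ~ rings (c k) v.
    by apply: no_ring.
  have out j : c j b = c j a -> forall v, a' < v <= b' -> ~ rings (c j) v.
    move=> E v /andP[av vu]; apply: (no_ring (cP _) a0 E).
    by rewrite (le_lt_trans aa' av) (le_trans vu).
  split; apply: interchange_still; rewrite ?a'0 //.
  - by move=> j /ckm E; exact: out.
  - exact: out.
  - by move=> j [<-].
have before u : a < u < s -> z u k = z a k /\ z u k.+1 = z a k.+1.
  move=> /andP[au us]; apply: quiet; rewrite ?lexx ?(ltW au)//.
    exact: le_trans (ltW us) sb.
  by rewrite !cs ?lexx ?as_ ?us ?(ltW au).
have after : z b k = z s k /\ z b k.+1 = z s k.+1.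
  by apply: quiet => //; rewrite sb (ltW as_).
have zzE i x : (forall u, a < u < s -> z u i = x) -> zz i = x.
  move=> H; have [r rs' Hr] := near_left_itv (zzl i).
  have [u [us ru au]] := between_left rs' as_.
  by rewrite -(Hr u) ?H ?au ?ru.
have [E1 E2] := sw k rs.
rewrite (proj1 after) (proj2 after) E1 E2; split; apply: zzE => u H.
  by have [] := before u H.
by have [] := before u H.
Qed.

(** Two rings of one clock and rings of two clocks are treated together, so that a union bound over
    pairs [j], [k] covers every collision. *)
Definition double_ring (j k : nat) : bool :=
  if j == k then (2 <= c k b - c k a)%N
  else (1 <= c j b - c j a)%N && (1 <= c k b - c k a)%N.

(** Clock [K] is included among the controlled ones because the swap at [k = K - 1] involves
    position [K], where clock [K] must be silent. *)
Lemma interchange_step K :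
  (forall j k, (j <= K)%N -> (k <= K)%N -> ~~ double_ring j k) ->
  (forall p, (p < K)%N -> z b p = z a p) \/
  exists2 k, (k < K)%N & (1 <= c k b - c k a)%N /\
    forall p, (p < K)%N -> z b p = z a (swap_at k p).
Proof.
move=> nd; have /andP[a0 ab'] := ab.
have mono k : (c k a <= c k b)%N by apply: (proj1 (cP k)).
have [[k [kK rk]]|nr] :=
    pselect (exists k, (k < K)%N /\ (1 <= c k b - c k a)%N); last first.
  have E k : (k < K)%N -> c k b = c k a.
    move=> kK; apply/eqP; rewrite eqn_leq mono andbT -subn_eq0 -leqn0 leqNgt.
    by apply/negP => H; apply: nr; exists k.
  left=> p pK; apply: interchange_still => //.
    by move=> s; apply: no_ring => //; exact: E.
  by move=> k pk s; apply: no_ring => //; apply: E; lia.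
right; exists k => //; split => //.
have ck : c k b = (c k a).+1.
  have := nd k k (ltnW kK) (ltnW kK); rewrite /double_ring eqxx.
  by have := mono k; lia.
have cj j : (j <= K)%N -> j != k -> c j b = c j a.
  move=> jK /negPf jk; have := nd j k jK (ltnW kK); rewrite /double_ring jk rk.
  by have := mono j; lia.
have [S1 S2] : z b k = z a k.+1 /\ z b k.+1 = z a k.
  apply: interchange_swap => //; first by apply: cj => //; lia.
  by move=> j kj; apply: cj; lia.
move=> p pK; rewrite /swap_at; case: eqVneq => [->//|pk].
case: eqVneq => [->//|pk1]; apply: interchange_still => //.
  by move=> s; apply: no_ring => //; apply: cj => //; lia.
by move=> j pj s; apply: no_ring => //; apply: cj => //; lia.
Qed.

End OneStep.

(* A silent clock q confines the positions 0, ..., q to a closed system. *)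
Lemma interchange_injective (c : nat -> R -> nat) (z : R -> nat -> nat)
    (ts : nat -> R) (m q M : nat) :
  (forall k, counting_path (c k)) -> interchange_path c z ->
  ts 0%N = 0 -> {homo ts : i j / (i <= j)%N >-> i <= j} -> (q < M)%N ->
  c q (ts m) = c q 0 ->
  (forall i j k, (i < m)%N -> (j <= M)%N -> (k <= M)%N ->
     ~~ double_ring c (ts i) (ts i.+1) j k) ->
  uniq [seq z (ts m) p | p <- iota 0 q.+1].
Proof.
move=> cP zP ts0 tsm qM cq nd.
rewrite map_inj_in_uniq ?iota_uniq//.
suff H i : (i <= m)%N -> {in [pred p | (p <= q)%N] &, injective (z (ts i))}.
  move=> p p'; rewrite !mem_iota !add0n => pq p'q; exact: (H m).
elim: i => [_ p p' _ _|i IH im].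
  by have [z0 _ _] := zP; rewrite ts0 !z0.
have t0 j : 0 <= ts j by rewrite -ts0 tsm.
have tS : 0 <= ts i <= ts i.+1 by rewrite t0 tsm.
have cqi : c q (ts i.+1) = c q (ts i).
  have mono := proj1 (cP q); apply/eqP; rewrite eqn_leq.
  rewrite (mono _ _ tS) andbT.
  apply: (@leq_trans (c q 0)); last by apply: mono; rewrite lexx t0.
  by rewrite -cq; apply: mono; rewrite t0 tsm.
have [H|[k kM [rk H]]] := interchange_step cP zP tS (fun j k => nd i j k im).
  move=> p p'; rewrite !inE => pq p'q; rewrite !H ?(leq_ltn_trans _ qM)//.
  by apply: IH => //; exact: ltnW.
have kq : k != q by apply/eqP => E; move: rk; rewrite E cqi subnn.
have sq p : (p <= q)%N -> (swap_at k p <= q)%N.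
  move: kq => /eqP kq; rewrite /swap_at.
  by case: (p =P k) => ?; case: (p =P k.+1) => ?; lia.
move=> p p'; rewrite !inE => pq p'q; rewrite !H ?(leq_ltn_trans _ qM)//.
move=> /(IH (ltnW im)); rewrite !inE => /(_ (sq _ pq) (sq _ p'q)).
rewrite /swap_at; case: (p =P k); case: (p =P k.+1); case: (p' =P k);
by case: (p' =P k.+1); lia.
Qed.

End InterchangePaths.

(** * Discrete random variables *)

Section DiscreteRandomVariables.
Context (d : measure_display) (T : measurableType d).

Lemma discrete_rv_set (D : Type) (X : T -> D) (Q : D -> Prop) :
  discrete_rv X -> measurable [set x | Q (X x)].
Proof. by move=> mX; exact: (mX [set y | Q y]). Qed.

Lemma discrete_rv_comp (D D' : Type) (X : T -> D) (f : D -> D') :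
  discrete_rv X -> discrete_rv (fun x => f (X x)).
Proof. by move=> mX B; exact: (mX (f @^-1` B)). Qed.

Lemma measurable_countable_bigcup (D : countType) (F : D -> set T) (B : set D) :
  (forall y, measurable (F y)) -> measurable (\bigcup_(y in B) F y).
Proof.
move=> mF.
have -> : \bigcup_(y in B) F y =
    \bigcup_(n in [set n | exists2 y, B y & unpickle n = Some y])
      (if unpickle n is Some y then F y else set0).
  apply/seteqP; split=> x [y By Fy].
    by exists (pickle y); [exists y; rewrite ?pickleK|rewrite pickleK].
  by case: By Fy => z Bz -> Fz; exists z.
by apply: bigcup_measurable => n _; case: unpickle.
Qed.

Lemma discrete_rv_countable (D : countType) (X : T -> D) :
  (forall y, measurable [set x | X x = y]) -> discrete_rv X.
Proof.
move=> mX B.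
have -> : X @^-1` B = \bigcup_(y in B) [set x | X x = y].
  by apply/seteqP; split=> [x Bx|x [y By /= ->]] //; exists (X x).
exact: measurable_countable_bigcup.
Qed.

(** Splitting along the countably many values of [X] allows random indices, as in
    [omega (zeta t k x) x]. *)
Lemma discrete_rv_bind (D : countType) (D' : Type) (X : T -> D)
    (F : D -> T -> D') :
  discrete_rv X -> (forall y, discrete_rv (F y)) ->
  discrete_rv (fun x => F (X x) x).
Proof.
move=> mX mF B.
have -> : (fun x => F (X x) x) @^-1` B =
    \bigcup_(y in [set: D]) ([set x | X x = y] `&` (F y @^-1` B)).
  by apply/seteqP; split=> [x Bx|x [y _ [/= <-]]] //; exists (X x).
apply: measurable_countable_bigcup => y; apply: measurableI; last exact: mF.
exact: (discrete_rv_set (fun z => z = y)).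
Qed.

Lemma discrete_rv_cst (D : Type) (y : D) : discrete_rv (fun _ : T => y).
Proof.
move=> B; have [By|nBy] := pselect (B y).
  by rewrite (_ : _ @^-1` _ = setT)//; apply/seteqP; split.
by rewrite (_ : _ @^-1` _ = set0)//; apply/seteqP; split.
Qed.

Lemma discrete_rv_pair (D D' : countType) (X : T -> D) (Y : T -> D') :
  discrete_rv X -> discrete_rv Y -> discrete_rv (fun x => (X x, Y x)).
Proof.
move=> mX mY; apply: (discrete_rv_bind (F := fun y x => (y, Y x))) => // y.
exact: discrete_rv_comp.
Qed.

Lemma discrete_rv_map (I : Type) (D : countType) (X : I -> T -> D) (s : seq I) :
  (forall i, discrete_rv (X i)) -> discrete_rv (fun x => [seq X i x | i <- s]).
Proof.
move=> mX; elim: s => [|i s IH] /=; first exact: discrete_rv_cst.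
exact: (discrete_rv_comp (fun p => p.1 :: p.2) (discrete_rv_pair (mX i) IH)).
Qed.

Lemma discrete_rv_ffun (I : finType) (D : countType) (X : I -> T -> D) :
  (forall i, discrete_rv (X i)) -> discrete_rv (fun x => [ffun i => X i x]).
Proof.
move=> mX B; have [[x0]|T0] := pselect (inhabited T); last first.
  rewrite (_ : _ @^-1` _ = set0)//; apply/seteqP; split=> // x.
  by case: T0; exists.
have := discrete_rv_comp
  (fun l => [ffun i => nth (X i x0) l (index i (enum I))])
  (discrete_rv_map (enum I) mX).
move=> /(_ B); congr measurable; apply/seteqP; split=> x /=;
  rewrite (_ : [ffun i => _] = [ffun i => X i x])//; apply/ffunP => i;
  by rewrite !ffunE (nth_map i) ?index_mem ?mem_enum// nth_index ?mem_enum.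
Qed.

End DiscreteRandomVariables.

(** * Real-valued probabilities, union bounds and countable partitions *)

Section RealProbability.
Context (R : realType) (d : measure_display) (T : measurableType d).
Variable P : probability T R.

Definition pr (A : set T) : R := fine (P A).

Lemma prE A : measurable A -> P A = (pr A)%:E.
Proof. by move=> mA; rewrite fineK// fin_num_measure. Qed.

Lemma pr_ge0 A : 0 <= pr A.
Proof. exact: fine_ge0. Qed.

Lemma pr_le1 A : measurable A -> pr A <= 1.
Proof. by move=> mA; rewrite -lee_fin -prE// probability_le1. Qed.

Lemma pr_set0 : pr set0 = 0.
Proof. by rewrite /pr measure0. Qed.

Lemma pr_le_ae A B : measurable A -> measurable B ->
  {ae P, forall x, A x -> B x} -> pr A <= pr B.
Proof.
move=> mA mB [C [mC C0 sC]]; rewrite -lee_fin -!prE//.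
apply: (@le_trans _ _ (P (B `|` C))).
  apply: le_measure; rewrite ?inE//; first exact: measurableU.
  move=> x Ax; have [Bx|nBx] := pselect (B x); [by left|right].
  by apply: sC => /(_ Ax).
have PC : P C = 0%E by exact: C0.
by rewrite -[leRHS]adde0 -PC; exact: measureU2.
Qed.

Lemma pr_le A B : measurable A -> measurable B -> A `<=` B -> pr A <= pr B.
Proof. by move=> mA mB AB; apply: pr_le_ae => //; apply: aeW. Qed.

Lemma pr_setU A B : measurable A -> measurable B -> pr (A `|` B) <= pr A + pr B.
Proof.
move=> mA mB; rewrite -lee_fin EFinD -!prE//; first exact: measureU2.
exact: measurableU.
Qed.

Lemma pr_cover (I : finType) (A : set T) (B : I -> set T) :
  measurable A -> (forall i, measurable (B i)) ->
  {ae P, forall x, A x -> exists i, B i x} -> pr A <= \sum_i pr (B i).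
Proof.
move=> mA mB AB.
apply: (@le_trans _ _ (pr (\big[setU/set0]_i B i))).
  apply: pr_le_ae => //; first exact: bigsetU_measurable.
  move: AB; apply: filterS => x H /H [i Bi].
  rewrite -bigcup_seq; exists i => //=; exact: mem_index_enum.
suff [] : measurable (\big[setU/set0]_i B i) /\
  pr (\big[setU/set0]_i B i) <= \sum_i pr (B i) by [].
apply: (big_ind2 (fun X x => measurable X /\ pr X <= x)) => [|X x Y y|i _].
- by rewrite pr_set0.
- move=> [mX HX] [mY HY]; split; first exact: measurableU.
  by apply: le_trans (pr_setU mX mY) _; exact: lerD.
- by split.
Qed.

Lemma pr_coverU (I : finType) (A C : set T) (B : I -> set T) :
  measurable A -> measurable C -> (forall i, measurable (B i)) ->
  {ae P, forall x, A x -> C x \/ exists i, B i x} ->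
  pr A <= pr C + \sum_i pr (B i).
Proof.
move=> mA mC mB AB; have mAC : measurable (A `\` C) by exact: measurableD.
apply: (@le_trans _ _ (pr (C `|` (A `\` C)))).
  apply: pr_le => //; first exact: measurableU.
  by move=> x Ax; have [|] := pselect (C x); [left|right].
apply: le_trans (pr_setU mC mAC) _; rewrite lerD2l; apply: pr_cover => //.
by move: AB; apply: filterS => x H [/H []].
Qed.

Lemma pr_setU_disjoint A B : measurable A -> measurable B -> A `&` B = set0 ->
  pr (A `|` B) = pr A + pr B.
Proof.
move=> mA mB AB; apply: EFin_inj; rewrite EFinD -!prE//; last exact: measurableU.
exact: measureU.
Qed.

Lemma pr_partition (F : finType) (X : T -> F) A : discrete_rv X ->
  measurable A -> pr A = \sum_a pr (A `&` [set x | X x = a]).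
Proof.
move=> mX mA.
have mAX (Q : F -> Prop) : measurable (A `&` [set x | Q (X x)]).
  by apply: measurableI => //; exact: discrete_rv_set.
suff H (s : seq F) : uniq s -> pr (A `&` [set x | X x \in s]) =
    \sum_(a <- s) pr (A `&` [set x | X x = a]).
  rewrite -H ?index_enum_uniq//; congr pr; apply/seteqP; split=> x //=.
    by move=> Ax; split=> //; exact: mem_index_enum.
  by case.
elim: s => [_|a s IH /= /andP[nas us]].
  by rewrite big_nil (_ : _ `&` _ = set0) ?pr_set0//; apply/seteqP; split=> // x [].
rewrite big_cons -IH// -pr_setU_disjoint//.
- congr pr; apply/seteqP; split=> x /=.
    by move=> [Ax]; rewrite inE => /predU1P[|]; [left|right].
  by move=> [[Ax ->]|[Ax xs]]; rewrite inE ?eqxx ?xs ?orbT.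
- exact: (mAX (fun z => z = a)).
- exact: (mAX (fun z => z \in s)).
- by apply/seteqP; split=> // x [[_ /= ->] [_]]; rewrite (negPf nas).
Qed.

(** Countable additivity over the values of [Y]: it replaces conditional expectations by a
    comparison on each atom, where [Y] is deterministic. *)
Lemma pr_countable_le (I : finType) (D : countType) (Y : T -> D)
    (A : I -> set T) (B : set T) (c : R) :
  discrete_rv Y -> (forall i, measurable (A i)) -> measurable B -> 0 <= c ->
  (forall y, \sum_i pr (A i `&` [set x | Y x = y]) <=
             c * pr (B `&` [set x | Y x = y])) ->
  \sum_i pr (A i) <= c * pr B.
Proof.
move=> mY mA mB c0 H.
pose E n := [set x | pickle (Y x) = n].
have mE n : measurable (E n) by exact: (discrete_rv_set (fun z => pickle z = n)).
have EP C : measurable C -> P C = (\sum_(0 <= n <oo) P (C `&` E n))%E.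
  move=> mC; apply/esym/cvg_lim => //.
  rewrite [X in _ --> P X](_ : C = \bigcup_n (C `&` E n)); last first.
    apply/seteqP; split=> [x Cx|x [n _ []]//]; by exists (pickle (Y x)).
  apply: measure_semi_sigma_additive => [n||]; first exact: measurableI.
  - apply/trivIsetP => i j _ _ ij; apply/seteqP; split=> // x [[_ /= Ei] [_ /= Ej]].
    by move: ij; rewrite -Ei -Ej eqxx.
  - by apply: bigcupT_measurable => n; exact: measurableI.
rewrite -lee_fin -sumEFin EFinM -prE//.
under eq_bigr do rewrite -prE//.
rewrite EP//; under eq_bigr do rewrite EP//.
rewrite -nneseries_sum//.
rewrite -nneseriesZl; last by move=> *; exact: measure_ge0.
apply: lee_nneseries => n _; first by move=> _; apply: sume_ge0 => i _; exact: measure_ge0.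
have mAE i : measurable (A i `&` E n) by exact: measurableI.
under eq_bigr do rewrite prE//.
rewrite prE; last exact: measurableI.
rewrite sumEFin -EFinM lee_fin.
have [[x xn]|nx] := pselect (exists x, pickle (Y x) = n).
  rewrite (_ : E n = [set x' | Y x' = Y x])//; apply/seteqP; split=> x' /=.
    by rewrite -xn => /(pcan_inj pickleK).
  by rewrite /E /= => ->.
rewrite big1 ?mulr_ge0 ?pr_ge0// => i _.
by rewrite (_ : _ `&` _ = set0) ?pr_set0//; apply/seteqP; split=> // x [_ xn];
  apply: nx; exists x.
Qed.

Lemma pr_setC A : measurable A -> pr (~` A) = 1 - pr A.
Proof.
move=> mA; apply: EFin_inj; rewrite -prE; last exact: measurableC.
by rewrite probability_setC// prE.
Qed.

End RealProbability.

(** * Poisson clocks on a grid of times *)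

(** Used to let the number of grid cells, and then the horizon, tend to infinity without handling
    limits. *)
Lemma le_of_le_inv (R : realType) (x a c : R) :
  (forall m : nat, x <= a + c / m.+1%:R) -> x <= a.
Proof.
move=> H; apply/ler_addgt0Pr => eps e0.
have [c0|c0] := leP c 0.
  apply: le_trans (H 0%N) _; rewrite divr1; lra.
have [m Hm] : exists m : nat, c / eps < m.+1%:R.
  exists (Num.truncn (c / eps)); exact: truncnS_gt.
apply: le_trans (H m) _; rewrite lerD2l ler_pdivrMr ?ltr0n//.
by rewrite mulrC -ler_pdivrMr// ltW.
Qed.

Section PoissonClocks.
Context (R : realType) (d : measure_display) (T : measurableType d).
Variable P : probability T R.
Implicit Types (a b : R).

Lemma discrete_rv_increment (N : R -> T -> nat) a b :
  poisson_process P N -> 0 <= a -> 0 <= b -> discrete_rv (fun x => (N b x - N a x)%N).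
Proof.
move=> [mN _ _ _] a0 b0.
exact: (discrete_rv_comp (fun p => (p.1 - p.2)%N) (discrete_rv_pair (mN _ b0) (mN _ a0))).
Qed.

Lemma pr_ring (N : R -> T -> nat) a b : poisson_process P N -> 0 <= a < b ->
  pr P [set x | (1 <= N b x - N a x)%N] = 1 - expR (- (b - a)).
Proof.
move=> pN /andP[a0 ab]; have mN := discrete_rv_increment pN a0 (le_trans a0 (ltW ab)).
rewrite (_ : [set x | _] = ~` [set x | (N b x - N a x)%N = 0%N]); last first.
  by apply/seteqP; split=> x /=; lia.
rewrite pr_setC; last exact: (discrete_rv_set (fun z => z = 0%N)).
have [_ _ /(_ a b) H _] := pN; rewrite /pr H ?a0 ?ab//=.
by rewrite /poisson_pmf subr_gt0 ab fact0 invr1 expr0 !mul1r.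
Qed.

Lemma pr_ring_le (N : R -> T -> nat) a b : poisson_process P N -> 0 <= a < b ->
  pr P [set x | (1 <= N b x - N a x)%N] <= b - a.
Proof.
by move=> pN ab; rewrite pr_ring//; have := expR_ge1Dx (- (b - a)); lra.
Qed.

(** With h the length of the interval, the probability is 1 - (1 + h) exp(-h), and exp(-h) >= 1 - h
    bounds it by 1 - (1 + h) (1 - h) = h^2. *)
Lemma pr_two_rings_le (N : R -> T -> nat) a b : poisson_process P N -> 0 <= a < b ->
  pr P [set x | (2 <= N b x - N a x)%N] <= (b - a) ^+ 2.
Proof.
move=> pN /andP[a0 ab]; have mN := discrete_rv_increment pN a0 (le_trans a0 (ltW ab)).
have m1 := discrete_rv_set (fun z => z = 1%N) mN.
have m2 := discrete_rv_set (fun z => (2 <= z)%N) mN.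
have E : pr P [set x | (1 <= N b x - N a x)%N] =
    pr P [set x | (N b x - N a x)%N = 1%N] + pr P [set x | (2 <= N b x - N a x)%N].
  rewrite -pr_setU_disjoint//.
    by congr pr; apply/seteqP; split=> x /=; lia.
  by apply/seteqP; split=> // x /= []; lia.
have [_ _ /(_ a b) H _] := pN.
have E1 : pr P [set x | (N b x - N a x)%N = 1%N] = (b - a) * expR (- (b - a)).
  rewrite /pr H ?a0 ?ab//=.
  by rewrite /poisson_pmf subr_gt0 ab invr1 expr1 mulr1.
rewrite pr_ring ?a0// E1 in E.
have := expR_ge1Dx (- (b - a)).
have ba : 0 < b - a by rewrite subr_gt0.
by nra.
Qed.

Definition interval_double_ring (N : nat -> R -> T -> nat) a b j k : set T :=
  [set x | double_ring (fun k s => N k s x) a b j k].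

Section Clocks.
Variable N : nat -> R -> T -> nat.
Hypothesis pN : forall k, poisson_process P (N k).
Hypothesis indN : mutually_independent P
  (fun k => <<s process_events [set s | 0 <= s] (N k) >>).

(** Increments of one clock lie in the sigma-algebra of that clock, as the mutual independence of
    the clocks requires. *)
Lemma increment_events k a b (Q : nat -> Prop) : 0 <= a -> 0 <= b ->
  <<s process_events [set s | 0 <= s] (N k) >>
    [set x | Q (N k b x - N k a x)%N].
Proof.
move=> a0 b0; set G := process_events _ _.
have mG s : 0 <= s -> @discrete_rv _ (g_sigma_algebraType G) _ (N k s).
  move=> s0 B; apply: sub_sigma_algebra; exists s => //; exists B => //.
  by rewrite setTI.
exact: (@discrete_rv_set _ (g_sigma_algebraType G) _ _
  (fun p => Q (p.1 - p.2)%N) (discrete_rv_pair (mG _ b0) (mG _ a0))).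
Qed.

Lemma measurable_double_ring a b j k : 0 <= a -> 0 <= b ->
  measurable (interval_double_ring N a b j k).
Proof.
move=> a0 b0; have mN k' := discrete_rv_increment (pN k') a0 b0.
exact: (discrete_rv_set (fun p => if j == k then (2 <= p.2)%N
   else (1 <= p.1)%N && (1 <= p.2)%N) (discrete_rv_pair (mN j) (mN k))).
Qed.

Lemma pr_double_ring_le a b j k : 0 <= a < b ->
  pr P (interval_double_ring N a b j k) <= (b - a) ^+ 2.
Proof.
move=> /andP[a0 ab]; rewrite /interval_double_ring /double_ring.
have b0 := le_trans a0 (ltW ab).
case: (eqVneq j k) => [_|jk]; first by rewrite pr_two_rings_le ?a0.
have E := indN (J := [:: j; k]) (A := fun i => [set x | (1 <= N i b x - N i a x)%N]).
rewrite (_ : [set x | _] =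
  \bigcap_(i in [set` [:: j; k]]) [set x | (1 <= N i b x - N i a x)%N]); last first.
  apply/seteqP; split=> x /=.
    by move=> /andP[? ?] i /=; rewrite !inE => /orP[]/eqP ->.
  by move=> H; apply/andP; split; apply: (H _) => /=; rewrite !inE eqxx ?orbT.
have m1 i : measurable [set x | (1 <= N i b x - N i a x)%N].
  exact: (discrete_rv_set (fun z => (1 <= z)%N) (discrete_rv_increment (pN i) a0 b0)).
rewrite /pr E; last 2 first.
- by rewrite /= inE jk.
- by move=> i _; exact: (increment_events (fun z => (1 <= z)%N) a0 b0).
rewrite !big_cons big_nil mule1 !prE// -EFinM /= expr2.
by rewrite ler_pM ?pr_ge0// pr_ring_le// a0.
Qed.

(** The value tends to 0 as [J] grows, so beyond any position some clock is almost surely silent up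
    to time [s]. *)
Lemma pr_all_ring s (q0 J : nat) : 0 < s ->
  pr P [set x | forall q, (q0 <= q < q0 + J)%N -> (1 <= N q s x - N q 0 x)%N] =
  (1 - expR (- s)) ^+ J.
Proof.
move=> s0.
have E := indN (J := iota q0 J) (A := fun i => [set x | (1 <= N i s x - N i 0 x)%N]).
rewrite (_ : [set x | _] =
  \bigcap_(i in [set` iota q0 J]) [set x | (1 <= N i s x - N i 0 x)%N]); last first.
  by apply/seteqP; split=> x /= H i; have := H i; rewrite /= mem_iota.
have m1 i : measurable [set x | (1 <= N i s x - N i 0 x)%N].
  exact: (discrete_rv_set (fun z => (1 <= z)%N)
    (discrete_rv_increment (pN i) (lexx 0) (ltW s0))).
rewrite /pr E ?iota_uniq//; last first.
  by move=> i _; apply: (increment_events (fun z => (1 <= z)%N)) => //; exact: ltW.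
have Ei i : P [set x | (1 <= N i s x - N i 0 x)%N] = (1 - expR (- s))%:E.
  by rewrite prE// pr_ring ?lexx// subr0.
under eq_bigr do rewrite Ei.
by rewrite prodEFin /= big_const_seq count_predT size_iota -Monoid.iteropE.
Qed.

Variable zeta : R -> nat -> T -> nat.
Hypothesis mz : forall (s : R) i, 0 <= s -> discrete_rv (zeta s i).
Hypothesis path_zeta :
  {ae P, forall x, interchange_path (fun k s => N k s x) (fun s i => zeta s i x)}.

Lemma counting_path_ae : {ae P, forall x k, counting_path (fun s => N k s x)}.
Proof.
apply/ae_foralln => k; have [_ + _ _] := pN k.
by apply: filterS => x [_ mono rc]; split.
Qed.

Definition grid s (m : nat) (i : nat) : R := i%:R * (s / m.+1%:R).

Lemma gridS s m i : grid s m i.+1 - grid s m i = s / m.+1%:R.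
Proof. by rewrite /grid -mulrBl -natrB// subSnn mul1r. Qed.

Lemma grid0 s m : grid s m 0 = 0. Proof. by rewrite /grid mul0r. Qed.

Lemma grid_end s m : grid s m m.+1 = s.
Proof. by rewrite /grid mulrC divfK// pnatr_eq0. Qed.

Lemma grid_ge0 s m i : 0 < s -> 0 <= grid s m i.
Proof. by move=> s0; rewrite mulr_ge0// divr_ge0// ltW. Qed.

Lemma grid_le s m : 0 < s -> {homo grid s m : i j / (i <= j)%N >-> i <= j}.
Proof. by move=> s0 i j ij; rewrite ler_wpM2r ?ler_nat// divr_ge0// ltW. Qed.

Lemma grid_lt s m i : 0 < s -> grid s m i < grid s m i.+1.
Proof. by move=> s0; rewrite -subr_gt0 gridS divr_gt0. Qed.

Definition zeta_prefix s K x : seq nat := [seq zeta s p x | p <- iota 0 K].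

Lemma discrete_rv_prefix s K : 0 <= s -> discrete_rv (zeta_prefix s K).
Proof. by move=> s0; apply: discrete_rv_map => i; exact: mz. Qed.

Lemma pr_not_uniq s K : 0 <= s -> pr P [set x | ~~ uniq (zeta_prefix s K x)] = 0.
Proof.
rewrite le_eqVlt => /predU1P[<-|s0].
  apply: le_anti; rewrite pr_ge0 andbT -[leRHS](pr_set0 P); apply: pr_le_ae => //.
    apply: (discrete_rv_set (fun z => ~~ uniq z)).
    exact: (discrete_rv_prefix _ (lexx 0)).
  move: path_zeta; apply: filterS => x [z0 _ _] /=.
  by rewrite /zeta_prefix map_inj_in_uniq ?iota_uniq// => p q _ _; rewrite !z0.
set A := [set x | _].
have mA : measurable A.
  apply: (discrete_rv_set (fun z => ~~ uniq z)).
  exact: (discrete_rv_prefix _ (ltW s0)).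
(* Either the [J] clocks from [K] on all ring by time [s], or some cell has a double ring among the
   clocks up to [K + J], or a silent clock keeps the labels distinct. The last term comes from
   [m.+1] cells, [(K + J).+1] squared pairs and the square of the mesh; it vanishes as [m] grows
   with [J] fixed. *)
have bound J m : pr P A <= (1 - expR (- s)) ^+ J +
    ((K + J).+1%:R * s) ^+ 2 / m.+1%:R.
  pose M := (K + J)%N.
  pose D (p : 'I_m.+1 * ('I_M.+1 * 'I_M.+1)) :=
    interval_double_ring N (grid s m p.1) (grid s m p.1.+1) p.2.1 p.2.2.
  pose C := [set x | forall q, (K <= q < K + J)%N -> (1 <= N q s x - N q 0 x)%N].
  have mD p : measurable (D p).
    by apply: measurable_double_ring; rewrite grid_ge0.
  apply: le_trans (pr_coverU (C := C) (B := D) mA _ mD _) _.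
  - rewrite (_ : C = \bigcap_(q in [set q | (K <= q < K + J)%N])
      [set x | (1 <= N q s x - N q 0 x)%N])//.
    apply: bigcap_measurableType => q _.
    exact: (discrete_rv_set (fun z => (1 <= z)%N)
      (discrete_rv_increment (pN q) (lexx 0) (ltW s0))).
  - move: path_zeta counting_path_ae; apply: filterS2 => x zP cP Ax.
    apply: contrapT => nB; apply: (negP Ax).
    have [q [qK nq]] : exists q, (K <= q < K + J)%N /\ N q s x = N q 0 x.
      apply: contrapT => nex; apply: nB; left => q qK.
      rewrite subn_gt0 ltnNge; apply/negP => Nq; apply: nex; exists q; split=> //.
      by apply/eqP; rewrite eqn_leq Nq; apply: (proj1 (cP q)); rewrite lexx ltW.
    have [/andP[Kq qJ]] : (K <= q)%N && (q < K + J)%N by [].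
    have := @interchange_injective R (fun k s => N k s x) (fun s i => zeta s i x)
      (grid s m) m.+1 q M cP zP (grid0 s m) (grid_le m s0) qJ.
    rewrite grid_end => /(_ nq); have nd : forall i j k : nat, (i < m.+1)%N ->
        (j <= M)%N -> (k <= M)%N ->
        ~~ double_ring (fun k s => N k s x) (grid s m i) (grid s m i.+1) j k.
      move=> i j k im jM kM; apply/negP => H; apply: nB.
      right; exists (Ordinal im, (Ordinal (jM : (j < M.+1)%N),
                                  Ordinal (kM : (k < M.+1)%N))).
      exact: H.
    move=> /(_ nd); rewrite -(subnKC (leqW Kq)) iotaD map_cat cat_uniq => /andP[].
    by [].
  rewrite pr_all_ring// lerD2l.
  apply: (@le_trans _ _ (\sum_(p : 'I_m.+1 * ('I_M.+1 * 'I_M.+1)) (s / m.+1%:R) ^+ 2)).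
    apply: ler_sum => p _; rewrite -(gridS s m p.1).
    by apply: pr_double_ring_le; rewrite grid_ge0// grid_lt.
  rewrite sumr_const -[_ *+ _]mulr_natl !card_prod !card_ord !natrM.
  have m0 : m.+1%:R != 0 :> R by rewrite pnatr_eq0.
  rewrite le_eqVlt; apply/predU1P; left; rewrite -/M.
  by move: (M.+1%:R : R) (m.+1%:R : R) m0 => M' m' m0; field.
apply: le_anti; rewrite pr_ge0 andbT.
have boundJ J : pr P A <= (1 - expR (- s)) ^+ J.
  by apply: le_of_le_inv => m; exact: bound.
have q1 : `|1 - expR (- s)| < 1.
  have e0 := expR_gt0 (- s).
  have e1 : expR (- s) < 1 by rewrite expR_lt1 oppr_lt0.
  by rewrite ger0_norm; lra.
have cv := cvg_expr q1.
rewrite -(cvg_lim (@norm_hausdorff _ _) cv).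
apply: limr_ge; first by apply/cvg_ex; exists 0.
by apply: nearW => J; exact: boundJ.
Qed.

End Clocks.
End PoissonClocks.

(** * Edges read through the interchange process *)

(** Membership in a generated sigma-algebra is phrased as [discrete_rv] over that sigma-algebra, so
    that the closure lemmas on discrete random variables also prove it. *)
Lemma discrete_rv_process (d : measure_display) (T : measurableType d)
    (I D : Type) (J : set I) (X : I -> T -> D) (G : set (set T)) i :
  process_events J X `<=` G -> J i ->
  @discrete_rv _ (g_sigma_algebraType G) _ (X i).
Proof.
move=> XG Ji B; apply: sub_sigma_algebra; apply: XG; exists i => //.
by exists B => //; rewrite setTI.
Qed.

Section Law.
Context (R : realType) (d : measure_display) (T : measurableType d).
Variable P : probability T R.
Variables (V : finType) (e : rel V).
Local Notation DE := (directed_edge e).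
Local Notation N := (#|DE|%:R : R).
Variables (eta0 : V -> T -> bool) (omega : nat -> T -> DE).
Variable zeta : R -> nat -> T -> nat.
Hypothesis m_eta0 : forall v, discrete_rv (eta0 v).
Hypothesis h_omega : iid P (fun=> #|DE|%:R^-1) omega.
Hypothesis h_eta0_omega : independent P <<s process_events setT eta0 >>
                                        <<s process_events setT omega >>.
Hypothesis mz : forall (s : R) i, 0 <= s -> discrete_rv (zeta s i).
Hypothesis h_zeta_indep : independent P
     <<s interchange_events zeta >>
     <<s process_events setT eta0 `|` process_events setT omega >>.
Implicit Types (a : {ffun V -> bool}).

(** A finite function, so that the starting configuration ranges over a [finType] and can be summed
    over. *)
Definition start (x : T) : {ffun V -> bool} := [ffun v => eta0 v x].
Definition draws (v : seq nat) (x : T) : seq DE := [seq omega j x | j <- v].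

Lemma discrete_rv_start : discrete_rv start.
Proof. exact: discrete_rv_ffun. Qed.

Lemma discrete_rv_draws v : discrete_rv (draws v).
Proof. by apply: discrete_rv_map => i; have [] := h_omega. Qed.

Lemma measurable_interchange Z : <<s interchange_events zeta >> Z -> measurable Z.
Proof.
move=> /(_ measurable); apply; split; first exact: sigma_algebra_measurable.
by move=> A [[s i] /= s0] [B _ <-]; rewrite setTI; exact: mz.
Qed.

Lemma pr_draws v s : uniq v -> size s = size v ->
  P [set x | draws v x = s] = (N^-1 ^+ size v)%:E.
Proof.
move=> uv; case: s => [|f0 s0].
  case: v uv => // _ _; rewrite (_ : [set x | _] = setT) ?probability_setT ?expr0//.
  by apply/seteqP; split.
move: (f0 :: s0) => s sv; have [m_omega p_omega i_omega] := h_omega.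
pose A j := [set x | omega j x = nth f0 s (index j v)].
have := i_omega v A uv; rewrite (_ : \bigcap_(i in [set` v]) A i =
  [set x | draws v x = s]); last first.
  apply/seteqP; split=> x /=.
    move=> H; apply: (@eq_from_nth _ f0); rewrite size_map// => i iv.
    have iv' : nth 0%N v i \in v by rewrite mem_nth.
    by rewrite (nth_map 0%N)// (H _ iv') index_uniq.
  move=> E j /= jv; rewrite /A /= -E (nth_map 0%N) ?index_mem//.
  by rewrite nth_index.
move=> ->; last by move=> i _; exists [set nth f0 s (index i v)] => //; rewrite setTI.
under eq_bigr do rewrite p_omega.
by rewrite prodEFin big_const_seq count_predT -Monoid.iteropE.
Qed.

Lemma pr_joint Z a v s : <<s interchange_events zeta >> Z ->
  uniq v -> size s = size v ->
  pr P (Z `&` [set x | start x = a] `&` [set x | draws v x = s]) =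
  pr P Z * pr P [set x | start x = a] * N^-1 ^+ size v.
Proof.
move=> zZ uv sv; rewrite -setIA /pr h_zeta_indep//; last first.
  set G := (X in <<s X >>).
  have m1 : @discrete_rv _ (g_sigma_algebraType G) _ start.
    apply: discrete_rv_ffun => i; apply: (@discrete_rv_process _ T _ _ setT) => //.
    by move=> A; left.
  have m2 : @discrete_rv _ (g_sigma_algebraType G) _ (draws v).
    apply: discrete_rv_map => i; apply: (@discrete_rv_process _ T _ _ setT) => //.
    by move=> A; right.
  exact: (@discrete_rv_set _ (g_sigma_algebraType G) _ _
    (fun p => p.1 = a /\ p.2 = s) (discrete_rv_pair m1 m2)).
rewrite h_eta0_omega; last 2 first.
- set G := process_events _ _.
  have m1 : @discrete_rv _ (g_sigma_algebraType G) _ start.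
    by apply: discrete_rv_ffun => i; apply: (@discrete_rv_process _ T _ _ setT).
  exact: (@discrete_rv_set _ (g_sigma_algebraType G) _ _ (fun z => z = a) m1).
- set G := process_events _ _.
  have m2 : @discrete_rv _ (g_sigma_algebraType G) _ (draws v).
    by apply: discrete_rv_map => i; apply: (@discrete_rv_process _ T _ _ setT).
  exact: (@discrete_rv_set _ (g_sigma_algebraType G) _ _ (fun z => z = s) m2).
rewrite pr_draws//.
rewrite prE; last exact: measurable_interchange.
rewrite [X in (_ * (X * _))%E]prE; last first.
  exact: (discrete_rv_set (fun z => z = a) discrete_rv_start).
by rewrite -!EFinM /= mulrA.
Qed.

Hypothesis N_gt0 : (0 < #|DE|)%N.

(** The bridge from [P] to [edge_mean]. In the induction the first draw is fixed and absorbed into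
    [A], while [c] gains a factor 1 / N; hence [A] and [c] are general. *)
Lemma pr_draws_pred (A : set T) (c : R) v (G : seq DE -> bool) :
  measurable A ->
  (forall s, size s = size v ->
     pr P (A `&` [set x | draws v x = s]) = c * N^-1 ^+ size v) ->
  pr P (A `&` [set x | G (draws v x)]) = 
  c * edge_mean (R := R) (size v) (fun s => (G s)%:R).
Proof.
elim: v A c G => [|j v IH] A c G mA H.
  have := H [::] erefl; rewrite /= expr0 mulr1 => <-; case: (G [::]).
    by rewrite mulr1; congr pr; apply/seteqP; split=> x [].
  by rewrite mulr0 (_ : _ `&` _ = set0) ?pr_set0//; apply/seteqP; split=> // x [].
have [m_omega _ _] := h_omega.
have mG (Q : DE -> Prop) : measurable (A `&` [set x | Q (omega j x)]).
  by apply: measurableI => //; exact: discrete_rv_set.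
rewrite (pr_partition P (m_omega j)); last first.
  apply: measurableI => //.
  exact: (discrete_rv_set (fun z => G z) (discrete_rv_draws (j :: v))).
rewrite /= mulrA mulr_sumr; apply: eq_bigr => f _.
rewrite -(IH (A `&` [set x | omega j x = f])); first last.
- move=> s sv; rewrite -mulrA -exprS -(H (f :: s)) /= ?sv//; congr pr.
  apply/seteqP; split=> x /=; first by move=> [[Ax ->] ->].
  by move=> [Ax [-> ->]].
- exact: (mG (fun z => z = f)).
by congr pr; apply/seteqP; split=> x /=; move=> [[Ax +] +]; [move=> + E|move=> E];
  rewrite E.
Qed.

(* Given the interchange process the edges read off at distinct times are
   again i.i.d. uniform and independent of the starting configuration. *)
Lemma sum_pr_uniq_prefix_le (I : finType) (Z : set T) (Zs : T -> seq nat) (L : nat)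
    (G : I -> {ffun V -> bool} -> seq DE -> bool) :
  <<s interchange_events zeta >> Z ->
  @discrete_rv _ (g_sigma_algebraType (interchange_events zeta)) _ Zs ->
  (forall x, size (Zs x) = L) ->
  \sum_i pr P (Z `&` [set x | uniq (Zs x)] `&`
               [set x | G i (start x) (draws (Zs x) x)]) <=
  (\sum_a pr P [set x | start x = a] *
     edge_mean (R := R) L (fun s => \sum_i (G i a s)%:R)) *
  pr P (Z `&` [set x | uniq (Zs x)]).
Proof.
move=> zZ zZs sZ.
have mZs : discrete_rv Zs by move=> B; apply: measurable_interchange; exact: (zZs B).
have mZ := measurable_interchange zZ.
have mu : measurable [set x | uniq (Zs x)] by exact: (discrete_rv_set (fun z => uniq z)).
have mG i : measurable [set x | G i (start x) (draws (Zs x) x)].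
  exact: (discrete_rv_set (fun p => G i p.1 p.2)
   (discrete_rv_pair discrete_rv_start (discrete_rv_bind mZs discrete_rv_draws))).
apply: (pr_countable_le mZs).
- by move=> i; apply: measurableI => //; exact: measurableI.
- exact: measurableI.
- apply: sumr_ge0 => a _; apply: mulr_ge0; first exact: pr_ge0.
  by apply: edge_mean_ge0 => // s; apply: sumr_ge0.
(* On each atom of [Zs] the edges are read at deterministic indices, and independence applies. *)
move=> y; set E := [set x | Zs x = y].
have mE : measurable E by exact: (discrete_rv_set (fun z => z = y)).
have [[uy sy]|nuy] := pselect (uniq y /\ size y = L); last first.
  rewrite big1 ?mulr_ge0 ?pr_ge0//.
    apply: sumr_ge0 => a _; apply: mulr_ge0; first exact: pr_ge0.
    by apply: edge_mean_ge0 => // s; apply: sumr_ge0.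
  move=> i _; rewrite (_ : _ `&` E = set0) ?pr_set0//; apply/seteqP; split=> // x.
  by move=> [[[_ /= ux] _]] Ex; apply: nuy; rewrite -Ex.
rewrite (_ : Z `&` _ `&` E = Z `&` E); last first.
  by apply/seteqP; split=> x; [move=> [[? _] ?]|move=> [? Ex]; split=> //; split=> //=;
    rewrite Ex].
have zZE : <<s interchange_events zeta >> (Z `&` E).
  apply: (@measurableI _ (g_sigma_algebraType (interchange_events zeta))) => //.
  exact: (@discrete_rv_set _ (g_sigma_algebraType _) _ _ (fun z => z = y) zZs).
have mZE : measurable (Z `&` E) by exact: measurableI.
rewrite mulr_suml.
have H i : pr P (Z `&` [set x | uniq (Zs x)] `&`
    [set x | G i (start x) (draws (Zs x) x)] `&` E) =
    \sum_a pr P [set x | start x = a] * edge_mean (R := R) L (fun s => (G i a s)%:R) *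
      pr P (Z `&` E).
  rewrite (pr_partition P discrete_rv_start); last first.
    by apply: measurableI => //; apply: measurableI => //; exact: measurableI.
  apply: eq_bigr => a _.
  rewrite mulrC mulrA -sy -(@pr_draws_pred (Z `&` E `&` [set x | start x = a])).
  - congr pr; apply/seteqP; split=> x /=.
      by move=> [[[[Zx _] +] Ex] sx]; rewrite Ex sx => Gx.
    by move=> [[[Zx Ex] sx] Gx]; rewrite Ex sx.
  - by apply: measurableI => //;
      exact: (discrete_rv_set (fun z => z = a) discrete_rv_start).
  - by move=> s ss; exact: pr_joint.
rewrite (eq_bigr _ (fun i _ => H i)) exchange_big; apply: ler_sum => a _ /=.
by rewrite edge_mean_sum mulr_sumr mulr_suml.
Qed.

End Law.

(** * Influence of the swaps on the consensus *)

Section Consensus.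
Context (d : measure_display) (T : measurableType d).
Variables (V : finType) (e : rel V).
Local Notation DE := (directed_edge e).

Lemma consensus_voter (eta : V -> bool) (w : nat -> DE) K v :
  ~~ non_consensus (voter eta w K) -> consensus eta w = voter eta w K v.
Proof.
move=> nc; have cst k : (K <= k)%N -> forall u, voter eta w k u = voter eta w K v.
  elim: k => [|k IH].
    rewrite leqn0 => /eqP K0 u.
    move: nc; rewrite K0 negb_exists => /forallP/(_ u); rewrite negb_exists.
    by move=> /forallP/(_ v); rewrite negbK => /eqP.
  rewrite leq_eqVlt => /predU1P[<-|/IH H] u.
  - move: nc; rewrite negb_exists => /forallP/(_ u); rewrite negb_exists.
    by move=> /forallP/(_ v); rewrite negbK => /eqP.
  - by rewrite /=; case: ifP.
rewrite /consensus; case E: (voter eta w K v).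
  by apply/asboolP; exists K => k Kk u; rewrite cst.
apply/asboolP => -[K' H]; have := H (maxn K K') (leq_maxr _ _) v.
by rewrite cst ?E// leq_maxl.
Qed.

Lemma discrete_rv_consensus (eta0 : V -> T -> bool) (w : nat -> T -> DE) :
  (forall v, discrete_rv (eta0 v)) -> (forall k, discrete_rv (w k)) ->
  discrete_rv (fun x => consensus (eta0 ^~ x) (w ^~ x)).
Proof.
move=> meta mw.
have mvoter k v : discrete_rv (fun x => voter (eta0 ^~ x) (w ^~ x) k v).
  elim: k v => [|k IH] v /=; first exact: meta.
  apply: (discrete_rv_bind (F := fun f x => if v == (val f).2
    then voter (eta0 ^~ x) (w ^~ x) k (val f).1 else voter (eta0 ^~ x) (w ^~ x) k v)) => //.
  by move=> f; case: (v == (val f).2); exact: IH.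
apply: discrete_rv_countable => b.
have mt : measurable [set x | consensus (eta0 ^~ x) (w ^~ x)].
  rewrite (_ : [set x | _] = \bigcup_K \bigcap_(k in [set k | (K <= k)%N])
     \bigcap_(v in [set: V]) [set x | voter (eta0 ^~ x) (w ^~ x) k v = true]).
    apply: bigcupT_measurable => K; apply: bigcap_measurableType => k _.
    apply: fin_bigcap_measurable => // v _.
    exact: (discrete_rv_set (fun z => z = true) (mvoter k v)).
  apply/seteqP; split=> x /=.
    by move=> /asboolP[K H]; exists K => // k Kk v _; exact: H.
  by move=> [K _ H]; apply/asboolP; exists K => k Kk v; exact: H.
case: b; first exact: mt.
rewrite (_ : [set x | _] = ~` [set x | consensus (eta0 ^~ x) (w ^~ x)]).
  exact: measurableC.
by apply/seteqP; split=> x /=; [move=> ->|move/negP/negbTE].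
Qed.

End Consensus.

(** * Comparison of the opinions at the times 0 and t *)

Section Stability.
Context (R : realType) (d : measure_display) (T : measurableType d).
Variable P : probability T R.
Variables (V : finType) (e : rel V).
Local Notation DE := (directed_edge e).
Local Notation N := (#|DE|%:R : R).
Variables (eta0 : V -> T -> bool) (omega : nat -> T -> DE).
Variable zeta : R -> nat -> T -> nat.
Hypothesis he : simple_graph e.
Hypothesis hc : connected_graph e.
Hypothesis m_eta0 : forall v, discrete_rv (eta0 v).
Hypothesis h_omega : iid P (fun=> #|DE|%:R^-1) omega.
Hypothesis h_eta0_omega : independent P <<s process_events setT eta0 >>
                                        <<s process_events setT omega >>.
Hypothesis mz : forall (s : R) i, 0 <= s -> discrete_rv (zeta s i).
Hypothesis h_zeta_indep : independent P
     <<s interchange_events zeta >>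
     <<s process_events setT eta0 `|` process_events setT omega >>.
Variable clock : nat -> R -> T -> nat.
Hypothesis h_clock : forall k, poisson_process P (clock k).
Hypothesis h_clock_indep : mutually_independent P
  (fun k => <<s process_events [set s | 0 <= s] (clock k) >>).
Hypothesis h_path :
  {ae P, forall x, interchange_path (fun k s => clock k s x) (fun s i => zeta s i x)}.
Variable f0 : DE.

Let N_gt0 : (0 < #|DE|)%N. Proof. by apply/card_gt0P; exists f0. Qed.

(** A function of [start] and finitely many draws, hence of countably valued variables. The prefix
    has length [K.+1] to match [swap_effect], although the opinion depends on its first [K] entries
    only. *)
Definition opinion (K : nat) (s : R) (x : T) : V -> bool :=
  voter (start eta0 x) (nth f0 (draws omega (zeta_prefix zeta s K.+1 x) x)) K.

Lemma nth_draws_prefix K s x p : (p < K)%N ->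
  nth f0 (draws omega (zeta_prefix zeta s K x) x) p = omega (zeta s p x) x.
Proof.
move=> pK; rewrite (nth_map 0%N) ?size_map ?size_iota//.
by rewrite (nth_map 0%N) ?size_iota// nth_iota.
Qed.

Lemma opinionE K s x :
  opinion K s x = voter (eta0 ^~ x) (fun k => omega (zeta s k x) x) K.
Proof.
rewrite /opinion (_ : (start eta0 x : V -> bool) = eta0 ^~ x); last first.
  by apply: funext => v; rewrite ffunE.
by apply: voter_ext => j jK; rewrite nth_draws_prefix// ltnS ltnW.
Qed.

Lemma discrete_rv_prefix_interchange s K : 0 <= s ->
  @discrete_rv _ (g_sigma_algebraType (interchange_events zeta)) _ (zeta_prefix zeta s K).
Proof.
move=> s0; apply: discrete_rv_map => i.
exact: (@discrete_rv_process _ T _ _ [set si : R * nat | 0 <= si.1]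
  (fun si => zeta si.1 si.2) _ (s, i)).
Qed.

Lemma discrete_rv_draws_prefix s K : 0 <= s ->
  discrete_rv (fun x => (start eta0 x, draws omega (zeta_prefix zeta s K x) x)).
Proof.
move=> s0; apply: discrete_rv_pair; first exact: discrete_rv_start.
apply: (discrete_rv_bind (discrete_rv_prefix mz K s0)) => v.
exact: discrete_rv_draws h_omega v.
Qed.

Lemma measurable_opinion_neq K a b v : 0 <= a -> 0 <= b ->
  measurable [set x | opinion K a x v != opinion K b x v].
Proof.
move=> a0 b0; exact: (discrete_rv_set
  (fun p : ({ffun V -> bool} * seq DE) * ({ffun V -> bool} * seq DE) =>
     voter p.1.1 (nth f0 p.1.2) K v != voter p.2.1 (nth f0 p.2.2) K v)
  (discrete_rv_pair (discrete_rv_draws_prefix K.+1 a0)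
                    (discrete_rv_draws_prefix K.+1 b0))).
Qed.

Lemma measurable_consensus_neq s : 0 <= s ->
  measurable [set x | consensus (eta0 ^~ x) (omega ^~ x)
                   <> consensus (eta0 ^~ x) (fun k => omega (zeta s k x) x)].
Proof.
move=> s0; have m_omega i : discrete_rv (omega i) by have [] := h_omega.
apply: (discrete_rv_set (fun p => p.1 <> p.2) (discrete_rv_pair _ _)).
  exact: discrete_rv_consensus.
apply: (discrete_rv_consensus (w := fun k x => omega (zeta s k x) x)) => // k.
by apply: (discrete_rv_bind (mz k _)).
Qed.

Lemma mean_start_le (F : {ffun V -> bool} -> R) B : (forall a, F a <= B) ->
  \sum_a pr P [set x | start eta0 x = a] * F a <= B.
Proof.
move=> FB; have m_start := discrete_rv_start m_eta0.
have E : \sum_a pr P [set x | start eta0 x = a] = 1.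
  transitivity (pr P setT); last by rewrite /pr probability_setT.
  rewrite (pr_partition P m_start)//; apply: eq_bigr => a _.
  by rewrite setTI.
rewrite -[leRHS]mul1r -E mulr_suml; apply: ler_sum => a _.
by rewrite ler_wpM2l ?pr_ge0.
Qed.

Lemma measurable_non_consensus K s : 0 <= s ->
  measurable [set x | non_consensus (opinion K s x)].
Proof.
move=> s0; exact: (discrete_rv_set (fun p : {ffun V -> bool} * seq DE =>
   non_consensus (voter p.1 (nth f0 p.2) K))
  (discrete_rv_draws_prefix K.+1 s0)).
Qed.

Lemma measurable_not_uniq K s : 0 <= s ->
  measurable [set x | ~~ uniq (zeta_prefix zeta s K x)].
Proof.
by move=> s0; exact: (discrete_rv_set (fun z => ~~ uniq z) (discrete_rv_prefix mz K s0)).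
Qed.

Lemma measurable_uniq K s : 0 <= s -> measurable [set x | uniq (zeta_prefix zeta s K x)].
Proof.
by move=> s0; exact: (discrete_rv_set (fun z => uniq z) (discrete_rv_prefix mz K s0)).
Qed.

Lemma pr_non_consensus K s : 0 <= s ->
  pr P [set x | non_consensus (opinion K.+1 s x)] <=
  N * (#|V|%:R ^+ 2 / 4) / K.+1%:R.
Proof.
move=> s0; set A := [set x | _].
have mA : measurable A by exact: measurable_non_consensus.
(* A single event: the bound for families is used with a one-element index set and with no condition
   on the labels. *)
pose G (i : 'I_1) (a : {ffun V -> bool}) (s : seq DE) :=
  non_consensus (voter a (nth f0 s) K.+1).
have := sum_pr_uniq_prefix_le m_eta0 h_omega h_eta0_omega mz h_zeta_indep N_gt0 G
   (@measurableT _ (g_sigma_algebraType (interchange_events zeta)))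
   (discrete_rv_prefix_interchange K.+2 s0).
move=> /(_ K.+2) H.
have {}H := H (fun x => etrans (size_map _ _) (size_iota _ _)).
rewrite big_ord1 setTI in H.
have mU := measurable_uniq K.+2 s0.
apply: (@le_trans _ _ (pr P [set x | ~~ uniq (zeta_prefix zeta s K.+2 x)] +
   pr P ([set x | uniq (zeta_prefix zeta s K.+2 x)] `&` A))).
  rewrite -pr_setU_disjoint//.
  - apply: pr_le => //; first apply: measurableU.
    + exact: measurable_not_uniq.
    + exact: measurableI.
    + by move=> x Ax /=; case: (boolP (uniq (zeta_prefix zeta s K.+2 x))) => ?; [right|left].
  - exact: measurable_not_uniq.
  - exact: measurableI.
  - by apply/seteqP; split=> // x [/= /negP nu [/= u _]].
rewrite (pr_not_uniq h_clock h_clock_indep mz h_path)// add0r.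
apply: (le_trans H); rewrite -[leRHS]mulr1; apply: ler_pM.
- apply: sumr_ge0 => a _; apply: mulr_ge0; first exact: pr_ge0.
  by apply: edge_mean_ge0 => // l; apply: sumr_ge0.
- exact: pr_ge0.
- apply: mean_start_le => a.
  rewrite (_ : edge_mean _ _ =
     iter K.+1 (voter_op e) (fun eta => (non_consensus eta)%:R : R) a).
    by rewrite ler_pdivlMr ?ltr0n// mulrC; exact: iter_non_consensus.
  rewrite -(edge_mean_voter N_gt0 f0 _ _ (leqnSn K.+1)).
  by apply: edge_mean_eq => // l _; rewrite big_ord1.
- by apply: pr_le1.
Qed.

Definition any_double_ring K (a b : R) : set T :=
  [set x | exists p : 'I_K.+1 * 'I_K.+1, interval_double_ring clock a b p.1 p.2 x].

Lemma measurable_any_double_ring K a b : 0 <= a < b ->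
  measurable (any_double_ring K a b).
Proof.
move=> /andP[a0 ab]; rewrite (_ : any_double_ring K a b =
  \bigcup_(p in [set: 'I_K.+1 * 'I_K.+1]) interval_double_ring clock a b p.1 p.2).
  apply: measurable_countable_bigcup => p.
  by apply: (measurable_double_ring h_clock) => //; exact: le_trans (ltW ab).
by apply/seteqP; split=> x [p]; [exists p|exists p].
Qed.

Lemma pr_any_double_ring K a b : 0 <= a < b ->
  pr P (any_double_ring K a b) <= K.+1%:R ^+ 2 * (b - a) ^+ 2.
Proof.
move=> hab; have /andP[a0 ab] := hab.
apply: (le_trans (pr_cover (B := fun p : 'I_K.+1 * 'I_K.+1 =>
   interval_double_ring clock a b p.1 p.2) _ _ _)).
- exact: measurable_any_double_ring.
- move=> p; apply: (measurable_double_ring h_clock) => //.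
  exact: le_trans (ltW ab).
- by apply: aeW => x [p]; exists p.
apply: (@le_trans _ _ (\sum_(p : 'I_K.+1 * 'I_K.+1) (b - a) ^+ 2)).
  by apply: ler_sum => p _; exact: pr_double_ring_le.
by rewrite sumr_const -[_ *+ _]mulr_natl card_prod !card_ord natrM -expr2.
Qed.

(** The trace on the labels of a ring of clock [k]. Being generated by [zeta], it is independent of
    the configuration and the edges, which is not known of the ring itself. *)
Definition shifted_by_swap K (a b : R) k : set T :=
  [set x | [seq zeta b p x | p <- iota 0 K] =
           [seq zeta a (swap_at k p) x | p <- iota 0 K]].

Lemma shifted_by_swap_events K a b k : 0 <= a -> 0 <= b ->
  <<s interchange_events zeta >> (shifted_by_swap K a b k).
Proof.
move=> a0 b0.
have m s i : 0 <= s ->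
  @discrete_rv _ (g_sigma_algebraType (interchange_events zeta)) _ (zeta s i).
  move=> s0; exact: (@discrete_rv_process _ T _ _ [set si : R * nat | 0 <= si.1]
  (fun si => zeta si.1 si.2) _ (s, i)).
exact: (@discrete_rv_set _ (g_sigma_algebraType _) _ _ (fun p => p.1 = p.2)
  (discrete_rv_pair (discrete_rv_map (iota 0 K) (fun p => m b p b0))
     (discrete_rv_map (iota 0 K) (fun p => m a (swap_at k p) a0)))).
Qed.

Lemma interchange_step_ae K a b : 0 <= a < b ->
  {ae P, forall x, ~ any_double_ring K a b x ->
    (forall p, (p < K)%N -> zeta b p x = zeta a p x) \/
    exists2 k, (k < K)%N & (1 <= clock k b x - clock k a x)%N /\
      forall p, (p < K)%N -> zeta b p x = zeta a (swap_at k p) x}.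
Proof.
move=> /andP[a0 ab]; move: h_path (counting_path_ae h_clock).
apply: filterS2 => x zP cP nd.
apply: (interchange_step cP zP); first by rewrite a0 ltW.
move=> j k jK kK; apply/negP => H; apply: nd.
by exists (Ordinal (jK : (j < K.+1)%N), Ordinal (kK : (k < K.+1)%N)).
Qed.

(** Without double rings the labels moved by at most one swap, and since they are distinct at time
    [a] this swap can only be the one at [k]. So clock [k] rang, which has probability at most
    [b - a]. *)
Lemma pr_shifted_by_swap K a b k : 0 <= a < b -> (k < K)%N ->
  pr P (shifted_by_swap K a b k `&` [set x | uniq (zeta_prefix zeta a K.+1 x)]) <=
  (b - a) + K.+1%:R ^+ 2 * (b - a) ^+ 2.
Proof.
move=> hab kK; have /andP[a0 ab] := hab; have b0 := le_trans a0 (ltW ab).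
have mS := measurable_interchange mz (shifted_by_swap_events K k a0 b0).
have mU := measurable_uniq K.+1 a0.
pose C := [set x | (1 <= clock k b x - clock k a x)%N].
have mC : measurable C by exact: (discrete_rv_set (fun z => (1 <= z)%N)
  (discrete_rv_increment (h_clock k) a0 b0)).
apply: (@le_trans _ _ (pr P (C `|` any_double_ring K a b))).
  apply: pr_le_ae.
  - exact: measurableI.
  - by apply: measurableU => //; exact: measurable_any_double_ring.
  move: (interchange_step_ae K hab); apply: filterS => x H [/= Sx Ux].
  have [Dx|/H] := pselect (any_double_ring K a b x); first by right.
  have {}Sx p : (p < K)%N -> zeta b p x = zeta a (swap_at k p) x.
    by move=> pK; move/eq_in_map: Sx; apply; rewrite mem_iota add0n.
  have inj p q : (p <= K)%N -> (q <= K)%N -> zeta a p x = zeta a q x -> p = q.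
    move=> pK qK E; apply/eqP.
    rewrite -(nth_uniq 0%N (s := zeta_prefix zeta a K.+1 x)) ?size_map ?size_iota//.
    by rewrite !(nth_map 0%N) ?size_iota// !nth_iota// !add0n E.
  have skk : swap_at k k = k.+1 by rewrite /swap_at eqxx.
  move=> [still|[k' k'K [rk' Sx']]].
    have := still k kK; rewrite Sx// skk => /inj E.
    by have := E kK (ltnW kK); lia.
  left; suff kk' : k = k' by rewrite /C /= kk'.
  have := Sx' k kK; rewrite Sx// skk => /inj; rewrite /swap_at.
  case: (k =P k') => // _; case: (k =P k'.+1) => [kE|_].
    by move=> /(_ kK (ltnW k'K)); lia.
  by move=> /(_ kK (ltnW kK)); lia.
apply: le_trans (pr_setU P mC (measurable_any_double_ring K hab)) _.
by apply: lerD; [exact: pr_ring_le|exact: pr_any_double_ring].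
Qed.

(** The first term pays for a double ring, once per vertex. Otherwise a change comes from one swap
    [k]; independence lets its probability multiply [swap_effect], and these effects sum over [k] to
    at most [B]. *)
Lemma sum_pr_opinion_change K a b B : 0 <= a < b -> 0 <= B ->
  (forall eta, \sum_(k < K) swap_effect R f0 k K eta <= B) ->
  \sum_v pr P [set x | opinion K a x v != opinion K b x v] <=
  #|V|%:R * (K.+1%:R ^+ 2 * (b - a) ^+ 2) +
  (b - a + K.+1%:R ^+ 2 * (b - a) ^+ 2) * B.
Proof.
move=> hab B0 HB; have /andP[a0 ab] := hab; have b0 := le_trans a0 (ltW ab).
pose h := b - a + K.+1%:R ^+ 2 * (b - a) ^+ 2.
have h0 : 0 <= h by rewrite addr_ge0 ?mulr_ge0 ?exprn_ge0 ?subr_ge0 ?ltW.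
pose G (k : nat) (v : V) (a : {ffun V -> bool}) (s : seq DE) :=
  voter a (nth f0 s) K v != voter a (nth f0 s \o swap_at k) K v.
pose E (k : 'I_K) (v : V) := shifted_by_swap K a b k `&`
  [set x | uniq (zeta_prefix zeta a K.+1 x)] `&`
  [set x | G k v (start eta0 x) (draws omega (zeta_prefix zeta a K.+1 x) x)].
have mS (k : nat) := measurable_interchange mz (shifted_by_swap_events K k a0 b0).
have mE k v : measurable (E k v).
  apply: measurableI; first by apply: measurableI => //; exact: measurable_uniq.
  exact: (discrete_rv_set (fun p => G k v p.1 p.2) (discrete_rv_draws_prefix K.+1 a0)).
have mnu := measurable_not_uniq K.+1 a0.
have mD := measurable_any_double_ring K hab.
have Hv v : pr P [set x | opinion K a x v != opinion K b x v] <=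
    K.+1%:R ^+ 2 * (b - a) ^+ 2 + \sum_(k < K) pr P (E k v).
  apply: (le_trans (pr_coverU (C := [set x | ~~ uniq (zeta_prefix zeta a K.+1 x)] `|`
    any_double_ring K a b) (B := E^~ v)
    (measurable_opinion_neq K v a0 b0) _ _ _)) => //.
  - exact: measurableU.
  - move: (interchange_step_ae K hab); apply: filterS => x H /= diff.
    have [Dx|nD] := pselect (any_double_ring K a b x); first by left; right.
    case: (boolP (uniq (zeta_prefix zeta a K.+1 x))) => [Ux|]; last by left; left.
    right; case: (H nD) => [still|[k kK [_ Sx]]].
      exfalso; move/negP: diff; apply; rewrite /opinion; apply/eqP.
      congr (_ v); apply: voter_ext => j jK; rewrite !nth_draws_prefix ?still//;
      by rewrite ltnS ltnW.
    exists (Ordinal kK); split.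
      split=> //; apply/eq_in_map => p; rewrite mem_iota add0n => /andP[_ pK].
      exact: Sx.
    suff : G k v (start eta0 x) (draws omega (zeta_prefix zeta a K.+1 x) x) by [].
    rewrite /G; apply: contra diff => /eqP Gx; apply/eqP; apply: (etrans Gx).
    rewrite /opinion; congr (_ v); apply: voter_ext => j jK; rewrite [LHS]/comp.
    rewrite !nth_draws_prefix ?Sx//; first by rewrite ltnS ltnW.
    by rewrite /swap_at; case: eqP => ?; [lia|case: eqP => ?; lia].
  rewrite lerD2r; apply: le_trans (pr_setU P mnu mD) _.
  rewrite (pr_not_uniq h_clock h_clock_indep mz h_path)// add0r.
  exact: pr_any_double_ring.
apply: (@le_trans _ _ (\sum_v (K.+1%:R ^+ 2 * (b - a) ^+ 2 + \sum_(k < K) pr P (E k v)))).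
  by apply: ler_sum => v _.
rewrite big_split /= sumr_const -[_ *+ _]mulr_natl lerD2l exchange_big /=.
apply: (@le_trans _ _ (\sum_(k < K) (\sum_c pr P [set x | start eta0 x = c] *
    swap_effect R f0 k K c) * h)).
  apply: ler_sum => k _.
  have := sum_pr_uniq_prefix_le m_eta0 h_omega h_eta0_omega mz h_zeta_indep N_gt0 (G k)
   (shifted_by_swap_events K k a0 b0) (discrete_rv_prefix_interchange K.+1 a0)
   (fun x => etrans (size_map _ _) (size_iota _ _)).
  move=> /le_trans; apply; apply: ler_pM.
  - apply: sumr_ge0 => c _; apply: mulr_ge0; first exact: pr_ge0.
    by apply: edge_mean_ge0 => // l; apply: sumr_ge0.
  - exact: pr_ge0.
  - by [].
  - exact: pr_shifted_by_swap.
rewrite -mulr_suml mulrC ler_wpM2l// exchange_big /=.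
under eq_bigr do rewrite -mulr_sumr.
exact: mean_start_le.
Qed.

Lemma pr_opinion_chain K t m v : 0 < t ->
  pr P [set x | opinion K 0 x v != opinion K t x v] <=
  \sum_(i < m.+1) pr P [set x | opinion K (grid t m i) x v !=
                                opinion K (grid t m i.+1) x v].
Proof.
move=> t0; have g0 := grid_ge0 m.
apply: (pr_cover (B := fun i : 'I_m.+1 => [set x | opinion K (grid t m i) x v !=
                                opinion K (grid t m i.+1) x v])).
- by apply: measurable_opinion_neq; rewrite ?lexx ?ltW.
- by move=> i; apply: measurable_opinion_neq; exact: g0.
apply: aeW => x /= diff; apply: contrapT => nex; move/negP: diff; apply; apply/eqP.
rewrite -(grid_end t m) -{1}(grid0 t m).
suff H i : (i <= m.+1)%N -> opinion K (grid t m 0) x v = opinion K (grid t m i) x v.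
  exact: H.
elim: i => [//|i IH] im; rewrite IH; last exact: ltnW.
apply/eqP; rewrite -[_ == _]negbK; apply/negP => H; apply: nex.
by exists (Ordinal im).
Qed.

(** The three terms are the influence of the swaps accumulated over the cells, the absence of
    consensus at step [K.+2] in one of the two runs, and the double rings over all cells. *)
Lemma pr_consensus_change t K m : 0 < t -> (0 < #|V|)%N ->
  let n : R := #|V|%:R in
  let c := N * (n ^+ 2 / 4) in
  let B := 2 * (max_degree e)%:R * n ^+ 2 / N + 2 * c / K.+1%:R in
  n * pr P [set x | consensus (eta0 ^~ x) (omega ^~ x)
                <> consensus (eta0 ^~ x) (fun k => omega (zeta t k x) x)] <=
  t * B + 2 * n * c / K.+2%:R + K.+3%:R ^+ 2 * t ^+ 2 * (n + B) / m.+1%:R.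
Proof.
move=> t0 V0 /=; set n : R := #|V|%:R; set c := N * (n ^+ 2 / 4).
set B := 2 * (max_degree e)%:R * n ^+ 2 / N + 2 * c / K.+1%:R; set X := [set x | _].
have n0 : 0 < n by rewrite ltr0n.
have c0 : 0 <= c by rewrite /c mulr_ge0 ?divr_ge0 ?exprn_ge0.
have B0 : 0 <= B by rewrite /B addr_ge0 ?divr_ge0 ?mulr_ge0 ?exprn_ge0.
have mX : measurable X by apply: measurable_consensus_neq; exact: ltW.
pose D v := [set x | opinion K.+2 0 x v != opinion K.+2 t x v].
(* Two runs that have both reached consensus, with different outcomes, disagree at every vertex.
   Comparing with the sum over the vertices then gains the factor [n]. *)
pose DA := [set x | forall v, opinion K.+2 0 x v != opinion K.+2 t x v].
have mD v : measurable (D v).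
  by apply: measurable_opinion_neq; rewrite ?lexx ?ltW.
have mDA : measurable DA.
  rewrite (_ : DA = \bigcap_(v in [set: V]) D v).
    by apply: fin_bigcap_measurable => // v _; exact: mD.
  by apply/seteqP; split=> x H v; [move=> _|]; exact: H.
have mN0 := measurable_non_consensus K.+2 (lexx (0 : R)).
have mNt := measurable_non_consensus K.+2 (ltW t0).
have XD : pr P X <= c / K.+2%:R + c / K.+2%:R + pr P DA.
  apply: (@le_trans _ _ (pr P (([set x | non_consensus (opinion K.+2 0 x)] `|`
     [set x | non_consensus (opinion K.+2 t x)]) `|` DA))).
    apply: pr_le_ae => //; first by do 2 apply: measurableU => //.
    move: h_path; apply: filterS => x [z0 _ _] Xx.
    have [nc0|nc0] := boolP (non_consensus (opinion K.+2 0 x)); first by left; left.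
    have [nct|nct] := boolP (non_consensus (opinion K.+2 t x)); first by left; right.
    right=> v; apply/eqP => E; apply: Xx; move: nc0 nct E.
    rewrite !opinionE => nc0 nct E.
    rewrite (consensus_voter v nct) -E -(consensus_voter v nc0); congr consensus.
    by apply: funext => k; rewrite z0.
  apply: le_trans (pr_setU P _ mDA) _; first exact: measurableU.
  rewrite lerD2r; apply: le_trans (pr_setU P mN0 mNt) _.
  by apply: lerD; apply: pr_non_consensus; rewrite ?lexx ?ltW.
pose h := t / m.+1%:R.
have nD : n * pr P DA <= m.+1%:R * (n * (K.+3%:R ^+ 2 * h ^+ 2) +
    (h + K.+3%:R ^+ 2 * h ^+ 2) * B).
  apply: (@le_trans _ _ (\sum_v pr P (D v))).
    rewrite /n mulr_natl -sumr_const; apply: ler_sum => v _; apply: pr_le => //.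
    by move=> x /(_ v).
  apply: (le_trans (ler_sum _ (fun v _ => pr_opinion_chain K.+2 m v t0))).
  rewrite exchange_big /= [leRHS]mulr_natl -[in leRHS](card_ord m.+1) -sumr_const.
  apply: ler_sum => i _; rewrite /h -(gridS t m i).
  apply: sum_pr_opinion_change => //; first by rewrite grid_ge0// grid_lt.
  by move=> eta; apply: sum_swap_effect; rewrite ?N_gt0.
apply: (@le_trans _ _ (n * (c / K.+2%:R + c / K.+2%:R + pr P DA))).
  by rewrite ler_wpM2l// ltW.
rewrite mulrDr; apply: (le_trans (lerD (lexx _) nD)).
rewrite le_eqVlt; apply/predU1P; left; rewrite /h.
have mm : m.+1%:R != 0 :> R by rewrite pnatr_eq0.
have KK : K.+2%:R != 0 :> R by rewrite pnatr_eq0.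
move: (m.+1%:R : R) (K.+2%:R : R) (K.+3%:R : R) mm KK B {B0 nD} => m' K2 K3 mm KK B.
by field; rewrite mm KK.
Qed.

End Stability.

Theorem theorem1p1 (R : realType) (d : measure_display) (T : measurableType d)
  (P : probability T R) (n : nat) (V : finType) (e : rel V) (p t : R)
  (eta0 : V -> T -> bool) (omega : nat -> T -> directed_edge e)
  (zeta : R -> nat -> T -> nat)
  (hn : (2 <= n)%N) (hV : #|V| = n)
  (he : simple_graph e) (hc : connected_graph e)
  (hp : 0 < p < 1) (ht : 0 < t)
  (h_eta0 : iid P (bernoulli_pmf p) eta0)
  (h_omega : iid P (fun=> #|directed_edge e|%:R^-1) omega)
  (h_eta0_omega : independent P <<s process_events setT eta0 >>
                                <<s process_events setT omega >>)
  (h_zeta : interchange_process P zeta)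
  (h_zeta_indep : independent P
     <<s interchange_events zeta >>
     <<s process_events setT eta0 `|` process_events setT omega >>) :
  (P [set x | consensus (eta0 ^~ x) (omega ^~ x)
              <> consensus (eta0 ^~ x) (fun k => omega (zeta t k x) x)]
   <= (3 * t * ((n * max_degree e)%:R / #|edges e|%:R))%:E)%E.
Proof.
(* A sample point provides a directed edge, which serves as default value and shows that the
   denominators are positive. *)
have [x0] : inhabited T by exact: (inhabits point).
pose f0 := omega 0%N x0.
have N_gt0 : (0 < #|directed_edge e|)%N by apply/card_gt0P; exists f0.
have V_gt0 : (0 < #|V|)%N by rewrite hV (leq_trans _ hn).
have E_gt0 : (0 < #|edges e|)%N.
  apply/card_gt0P; exists [set (val f0).1; (val f0).2]%SET; rewrite inE.
  apply/existsP; exists (val f0).1; apply/existsP; exists (val f0).2.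
  by rewrite eqxx andbT; exact: (valP f0).
have [m_eta0 _ _] := h_eta0.
have [mz [clock [h_clock h_clock_indep h_path]]] := h_zeta.
set X := [set x | _].
have mX : measurable X := measurable_consensus_neq m_eta0 h_omega mz (ltW ht).
rewrite (prE P mX) lee_fin.
set N : R := #|directed_edge e|%:R; set nn : R := #|V|%:R.
have N0 : 0 < N by rewrite ltr0n.
have nn0 : 0 < nn by rewrite ltr0n.
set D : R := (max_degree e)%:R.
have D0 : 0 <= D by rewrite ler0n.
have H : nn * pr P X <= t * (2 * D * nn ^+ 2 / N).
  (* The limit in [m] is taken inside the limit in [K], since the double-ring error grows with
     [K]. *)
  apply: (@le_of_le_inv _ _ _ (t * (2 * (N * (nn ^+ 2 / 4))) +
      2 * nn * (N * (nn ^+ 2 / 4)))) => K.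
  apply: (@le_of_le_inv _ _ _ (K.+3%:R ^+ 2 * t ^+ 2 *
      (nn + (2 * D * nn ^+ 2 / N + 2 * (N * (nn ^+ 2 / 4)) / K.+1%:R)))) => m.
  apply: (le_trans (pr_consensus_change he hc m_eta0 h_omega h_eta0_omega mz
     h_zeta_indep h_clock h_clock_indep h_path f0 K m ht V_gt0)).
  rewrite /= -/N -/nn -/D lerD2r.
  have : K.+2%:R^-1 <= K.+1%:R^-1 :> R by rewrite lef_pV2 ?posrE ?ltr0n// ler_nat.
  have : 0 <= 2 * nn * (N * (nn ^+ 2 / 4)).
    by rewrite !mulr_ge0 ?invr_ge0 ?exprn_ge0 ?ltW.
  move: (N * _) (2 * D * _ / N) (K.+1%:R^-1 : R) (K.+2%:R^-1 : R) => c A k k2 c0 kk.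
  by have := ler_wpM2l c0 kk; lra.
have {}H : pr P X <= 2 * t * (nn * D / N).
  rewrite -(ler_pM2l nn0); apply: (le_trans H); rewrite le_eqVlt; apply/predU1P; left.
  by field; rewrite gt_eqF.
apply: (le_trans H).
have -> : (n * max_degree e)%:R = nn * D :> R by rewrite natrM /nn hV.
have nD : 0 <= nn * D by apply: mulr_ge0 => //; exact: ltW.
have t2 : 0 <= 2 * t by rewrite mulr_ge0// ltW.
(* The constant obtained is 2, with directed edges in the denominator; passing to undirected edges
   and to 3 only enlarges the bound. *)
apply: (@le_trans _ _ (2 * t * (nn * D / #|edges e|%:R))).
  do 2 apply: ler_wpM2l => //.
  by rewrite lef_pV2 ?posrE ?ltr0n// ler_nat card_edges_le.
apply: ler_wpM2r; first by apply: mulr_ge0 => //; rewrite invr_ge0.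
by apply: ler_wpM2r; [exact: ltW|rewrite ler_nat].
Qed.
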